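(* Let $R$ be a field of characteristic different from $2$ and $3$, made into a $\mathbb{Z}[\delta^{\pm1}]$-algebra by sending $\delta$ to some nonzero element of $R$. Then ${\rm Br}({\rm G}_2)\otimes_{\mathbb{Z}[\delta^{\pm1}]}R$ is a cellularly stratified algebra.
   Context: Let $\delta$ be an indeterminate. ${\rm Br}({\rm G}_2)$ is the $\mathbb{Z}[\delta^{\pm1}]$-algebra generated by $r_0,r_1,e_0,e_1$ subject to the following relations: - $r_0^2=r_1^2=1$; - $r_ie_i=e_ir_i=e_i$ for $i=0,1$; - $e_0^2=\delta^3e_0$ and $e_1^2=\delta e_1$; - $r_0e_1e_0=r_1e_0$ and $e_0e_1r_0=e_0r_1$; - $e_1r_0e_1r_0e_1=e_1$ and $e_1r_0e_1r_0r_1=e_1r_0r_1r_0$; - $e_0r_1e_0=\delta^2e_0$; - $r_1r_0e_1r_0e_1=r_0r_1r_0e_1$; - $(r_1r_0)^6=1$. ''Cellularly stratified'' is in the sense of Hartmann, Henke, Koenig and Paget. A finite-dimensional algebra $A$ with an anti-involution is cellularly stratified if the following hold. - $A$ is an iterated inflation of cellular algebras $B_1,\dots,B_n$ along vector spaces $V_1,\dots,V_n$. In particular, as a vector space $A=\bigoplus_l V_l\otimes V_l\otimes B_l$, and the partial sums over an initial segment of the layers are two-sided ideals. - For each $l$ there are nonzero $u_l,v_l\in V_l$ such that $e_l=u_l\otimes v_l\otimes 1_{B_l}$ is an idempotent. - $e_le_m=e_m=e_me_l$ whenever $l>m$. *)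

(* Defs.v *)
From HB Require Import structures.
From mathcomp Require Import all_boot all_order all_algebra.
Set Implicit Arguments. Unset Strict Implicit. Unset Printing Implicit Defensive.
Import Order.TTheory GRing.Theory Num.Theory.
Local Open Scope ring_scope.

Section Defs.
Variable R : fieldType.

Definition BrG2_rel (A : algType R) (d : R) (r0 r1 e0 e1 : A) : Prop :=
  (r0 * r0 = 1 /\ r1 * r1 = 1) /\
  [/\ r0 * e0 = e0, e0 * r0 = e0, r1 * e1 = e1 & e1 * r1 = e1] /\
  (e0 * e0 = d ^+ 3 *: e0 /\ e1 * e1 = d *: e1) /\
  (r0 * e1 * e0 = r1 * e0 /\ e0 * e1 * r0 = e0 * r1) /\
  (e1 * r0 * e1 * r0 * e1 = e1 /\ e1 * r0 * e1 * r0 * r1 = e1 * r0 * r1 * r0) /\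
  e0 * r1 * e0 = d ^+ 2 *: e0 /\
  r1 * r0 * e1 * r0 * e1 = r0 * r1 * r0 * e1 /\
  (r1 * r0) ^+ 6 = 1.

Definition alg_hom (A B : algType R) (f : A -> B) : Prop :=
  [/\ forall x y, f (x + y) = f x + f y,
      forall (c : R) x, f (c *: x) = c *: f x,
      forall x y, f (x * y) = f x * f y
    & f 1 = 1].

(* A, with r0 r1 e0 e1, is the R-algebra presented by the generators and
   relations of Br(G_2) with delta |-> d (universal property). *)
Definition BrG2_universal (A : algType R) (d : R) (r0 r1 e0 e1 : A) : Prop :=
  forall (B : algType R) (s0 s1 f0 f1 : B), BrG2_rel d s0 s1 f0 f1 ->
    exists f : A -> B,
      [/\ alg_hom f, [/\ f r0 = s0, f r1 = s1, f e0 = f0 & f e1 = f1] &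
          forall g : A -> B, alg_hom g ->
            [/\ g r0 = s0, g r1 = s1, g e0 = f0 & g e1 = f1] ->
            forall x, g x = f x].

Definition anti_involution (A : algType R) (s : A -> A) : Prop :=
  [/\ forall (c : R) x y, s (c *: x + y) = c *: s x + s y,
      forall x y, s (x * y) = s y * s x
    & forall x, s (s x) = x].

(* Cellular algebras in the sense of Graham--Lehrer.  The cell datum   *)
(* is a finite poset (Lam, le), finite index sets M lam and a basis    *)
(* C lam s t of B, indexed by the finite type idx below.               *)
Definition cell_idx (Lam : finType) (M : Lam -> finType) : finType :=
  {lam : Lam & (M lam * M lam)%type}.

Definition cellular (B : algType R) (sigma : B -> B) : Prop :=
  anti_involution sigma /\
  exists (Lam : finType) (le : rel Lam) (M : Lam -> finType)
         (C : cell_idx M -> B),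
    let Cb lam s t := C (@existT Lam (fun l => (M l * M l)%type) lam (s, t)) in
    let lower (lam : Lam) (x : B) :=
      exists c : cell_idx M -> R,
        x = \sum_(i | le (tag i) lam && (tag i != lam)) c i *: C i in
    [/\ [/\ forall x, le x x,
            forall x y, le x y -> le y x -> x = y
          & forall x y z, le x y -> le y z -> le x z],
        (forall b, exists c : cell_idx M -> R, b = \sum_i c i *: C i),
        (forall c : cell_idx M -> R, \sum_i c i *: C i = 0 -> forall i, c i = 0),
        (forall lam s t, sigma (Cb lam s t) = Cb lam t s)
      & forall (a : B) (lam : Lam) (s : M lam),
          exists r : M lam -> R, forall t : M lam,
            lower lam (a * Cb lam s t - \sum_(s' : M lam) r s' *: Cb lam s' t)].

(* A layer of an iterated inflation: a cellular algebra B with its     *)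
(* involution, a vector space V = R^d (d = dim V), and the bilinear     *)
(* form phi : V x V -> B recorded by its Gram matrix.                   *)
(* V (x) V (x) B is identified with d x d matrices over B:              *)
(* u (x) v (x) b  <->  the matrix with (i,j) entry u_i v_j b.           *)
Record layer := Layer {
  lB : algType R;
  lsigma : lB -> lB;
  ld : nat;
  lphi : 'M[lB]_ld
}.

Definition mx_scale (L : layer) (c : R) (M : 'M[lB L]_(ld L)) : 'M[lB L]_(ld L) :=
  map_mx (fun x => c *: x) M.

Definition tens_one (L : layer) (u v : 'rV[R]_(ld L)) : 'M[lB L]_(ld L) :=
  \matrix_(i, j) ((u 0 i * v 0 j) *: (1 : lB L)).

Section IterInfl.
Variables (A : algType R) (iota : A -> A) (n : nat) (L : 'I_n -> layer)
          (th : forall l : 'I_n, 'M[lB (L l)]_(ld (L l)) -> A).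

Definition layers_le (l : 'I_n) (x : A) : Prop :=
  exists M : forall m : 'I_n, 'M[lB (L m)]_(ld (L m)),
    x = \sum_(m < n | (m <= l)%N) @th m (M m).
Definition layers_lt (l : 'I_n) (x : A) : Prop :=
  exists M : forall m : 'I_n, 'M[lB (L m)]_(ld (L m)),
    x = \sum_(m < n | (m < l)%N) @th m (M m).

(* A is an iterated inflation of the cellular algebras B_l along the
   vector spaces V_l, l = 1..n (here indexed by 'I_n), with respect to
   the anti-involution iota; th l embeds V_l (x) V_l (x) B_l into A. *)
Definition iterated_inflation : Prop :=
      (forall l : 'I_n, cellular (@lsigma (L l))) /\
      (forall (l : 'I_n) i j, lsigma (lphi (L l) i j) = lphi (L l) j i) /\
      (forall (l : 'I_n) M N, @th l (M + N) = @th l M + @th l N :> A) /\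
      (forall (l : 'I_n) (c : R) M, @th l (mx_scale c M) = c *: @th l M :> A) /\
      (forall x : A, exists M : forall m : 'I_n, 'M[lB (L m)]_(ld (L m)),
          x = \sum_(m < n) @th m (M m)) /\
      (forall M : forall m : 'I_n, 'M[lB (L m)]_(ld (L m)),
          \sum_(m < n) @th m (M m) = 0 -> forall m, M m = 0) /\
      (forall (l : 'I_n) (a x : A), layers_le l x -> layers_le l (a * x) /\ layers_le l (x * a)) /\
      (* the involution acts by a (x) b (x) x |-> b (x) a (x) sigma(x) *)
      (forall (l : 'I_n) M, iota (@th l M) = @th l (map_mx (@lsigma (L l)) M)^T) /\
      (* multiplication in a layer is the inflation multiplication
         (a (x) b (x) x)(c (x) d (x) y) = a (x) d (x) x phi(b,c) y,
         modulo lower layers *)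
      (forall (l : 'I_n) M N, layers_lt l (@th l M * @th l N - @th l (M *m lphi (L l) *m N))) /\
      (* left multiplication by any element of A acts on a layer, modulo
         lower layers, without changing the right V-factor *)
      forall (l : 'I_n) (a : A), exists P : 'M[lB (L l)]_(ld (L l)),
        forall M, layers_lt l (a * @th l M - @th l (P *m M)).

End IterInfl.

(* Cellularly stratified algebras (Hartmann--Henke--Koenig--Paget),
   with respect to the anti-involution iota. *)
Definition cellularly_stratified (A : algType R) (iota : A -> A) : Prop :=
  [/\ anti_involution iota,
      exists s : seq A, forall x : A, exists c : 'I_(size s) -> R,
        x = \sum_(i < size s) c i *: s`_i
    & exists (n : nat) (L : 'I_n -> layer)
             (th : forall l : 'I_n, 'M[lB (L l)]_(ld (L l)) -> A),
        iterated_inflation iota th /\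
        exists u v : forall l : 'I_n, 'rV[R]_(ld (L l)),
          let e l := th l (tens_one (u l) (v l)) in
          [/\ forall l, u l != 0 /\ v l != 0,
              forall l, e l * e l = e l
            & forall l m : 'I_n, (m < l)%N -> e l * e m = e m /\ e m * e l = e m]].

End Defs.

(* Main.v *)
(** Completing the defining relations of Br(G_2) to a confluent rewriting system
    shows that, up to powers of delta, the algebra is a monoid algebra on 39
    reduced words.  The twisted monoid algebra on these words satisfies the
    relations, and sending a basis element to its word inverts the map given by
    the universal property, so it is isomorphic to Br(G_2).

    Every reduced word can be written a_i c_b a_j^*, where * reverses words: with
    c_b = e0 and three a_i; with c_b = e1 or e1 r0 e1 and three a_i; or with c_b in
    the dihedral group of order 12 and a single a_i = 1.  This exhibits an iterated
    inflation of R, R[Z/2] and R[D_12] along spaces of dimension 3, 3 and 1,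
    because multiplication on the left changes only the pair (i, b), unless it
    falls into a lower layer.  The idempotents are r0 r1 e0 r1 r0 / delta^3,
    e1 / delta and 1.  The group algebras are cellular by means of a
    Kazhdan-Lusztig basis.  All identities between basis elements are statements
    about finite tables of natural numbers and are decided by evaluation. *)
Require Import Defs.
From HB Require Import structures.
From mathcomp Require Import all_boot all_order all_algebra.
Import GRing.Theory.
Local Open Scope ring_scope.
Set Implicit Arguments.
Unset Strict Implicit.
Unset Printing Implicit Defensive.

(** * Twisted monoid algebras *)

(** Linearity as a bare predicate, to fit the unbundled maps in [alg_hom] and [anti_involution]. *)
Definition linmap (R : pzRingType) (V W : lmodType R) (f : V -> W) : Prop :=
  forall c x y, f (c *: x + y) = c *: f x + f y.

Section LinMap.
Variables (R : pzRingType) (V W : lmodType R) (f : V -> W).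
Hypothesis fL : linmap f.

Lemma linmap0 : f 0 = 0.
Proof.
by have := fL (-1) 0 0; rewrite scaler0 addr0 scaleN1r addNr.
Qed.

Lemma linmapD x y : f (x + y) = f x + f y.
Proof. by have := fL 1 x y; rewrite !scale1r. Qed.

Lemma linmapZ c x : f (c *: x) = c *: f x.
Proof. by have := fL c x 0; rewrite !addr0 linmap0 addr0. Qed.

Lemma linmapB x y : f (x - y) = f x - f y.
Proof. by rewrite -scaleN1r linmapD linmapZ scaleN1r. Qed.

Lemma linmap_sum (I : Type) (r : seq I) (P : pred I) (F : I -> V) :
  f (\sum_(i <- r | P i) F i) = \sum_(i <- r | P i) f (F i).
Proof. exact: (big_morph f linmapD linmap0). Qed.

End LinMap.

(** A monoid with a normalised 2-cocycle, written additively as an exponent; [twtA] is the cocycle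
    identity. *)
Record tmonoid := TMonoid {
  tcar :> finType;
  tone : tcar;
  tmul : tcar -> tcar -> tcar;
  twt : tcar -> tcar -> nat;
  tmulA : forall x y z, tmul x (tmul y z) = tmul (tmul x y) z;
  tmul1m : forall x, tmul tone x = x;
  tmulm1 : forall x, tmul x tone = x;
  twtA : forall x y z,
    (twt x y + twt (tmul x y) z = twt y z + twt x (tmul y z))%N;
  twt1m : forall x, twt tone x = 0%N;
  twtm1 : forall x, twt x tone = 0%N
}.

(* The algebra with basis [m] and product [x . y = d ^ (twt x y) (tmul x y)]. *)
Definition talg (R : fieldType) (d : R) (m : tmonoid) : Type := {ffun m -> R}.

Section TwistedMonoidAlgebra.
Variables (R : fieldType) (d : R) (m : tmonoid).
Local Notation T := (talg d m).

HB.instance Definition _ := GRing.Zmodule.copy T {ffun m -> R}.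

Definition tscale (c : R) (x : T) : T := [ffun i => c * x i].

Fact tscaleA a b x : tscale a (tscale b x) = tscale (a * b) x.
Proof. by apply/ffunP => i; rewrite !ffunE mulrA. Qed.
Fact tscale1 : left_id 1 tscale.
Proof. by move=> x; apply/ffunP => i; rewrite !ffunE mul1r. Qed.
Fact tscaleDr : right_distributive tscale +%R.
Proof. by move=> c x y; apply/ffunP => i; rewrite !ffunE mulrDr. Qed.
Fact tscaleDl x : {morph tscale^~ x : a b / a + b}.
Proof. by move=> a b; apply/ffunP => i; rewrite !ffunE mulrDl. Qed.

HB.instance Definition _ :=
  GRing.Zmodule_isLmodule.Build R T tscaleA tscale1 tscaleDr tscaleDl.

Lemma talgP (x y : T) : (forall i, x i = y i) <-> x = y.
Proof. by split => [/ffunP//|->]. Qed.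

Lemma talgD (x y : T) i : (x + y) i = x i + y i.
Proof. by rewrite ffunE. Qed.
Lemma talg0 i : (0 : T) i = 0.
Proof. by rewrite ffunE. Qed.
Lemma talgN (x : T) i : (- x) i = - x i.
Proof. by rewrite ffunE. Qed.
Lemma talgZ c (x : T) i : (c *: x) i = c * x i.
Proof. by rewrite ffunE. Qed.
Lemma talg_sum (I : Type) (r : seq I) (P : pred I) (F : I -> T) i :
  (\sum_(j <- r | P j) F j) i = \sum_(j <- r | P j) F j i.
Proof. exact: (big_morph (fun x : T => x i) (fun x y => talgD x y i) (talg0 i)). Qed.
Definition talgE := (talgD, talg0, talgN, talgZ, talg_sum).

Definition tdelta (i : m) : T := [ffun j => (i == j)%:R].

Lemma tdeltaE i j : tdelta i j = (i == j)%:R.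
Proof. by rewrite ffunE. Qed.

Lemma talg_basis (x : T) : x = \sum_i x i *: tdelta i.
Proof.
apply/talgP => k; rewrite talgE (bigD1 k) //= talgE tdeltaE eqxx mulr1.
rewrite big1 ?addr0 // => j /negPf jk; by rewrite talgE tdeltaE jk mulr0.
Qed.

(** Multilinear identities are reduced to basis elements by one use of this for each argument. *)
Lemma talg_lin_ext (V : lmodType R) (f g : T -> V) : linmap f -> linmap g ->
  (forall i, f (tdelta i) = g (tdelta i)) -> forall x, f x = g x.
Proof.
move=> fL gL fg x; rewrite (talg_basis x) (linmap_sum fL) (linmap_sum gL).
by apply: eq_bigr => i _; rewrite (linmapZ fL) (linmapZ gL) fg.
Qed.

Definition tlmul (x y : T) : T :=
  \sum_i \sum_j (x i * y j) *: (d ^+ twt i j *: tdelta (tmul i j)).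

Lemma tlmulL y : linmap (tlmul^~ y).
Proof.
move=> c x x'; rewrite /tlmul scaler_sumr -big_split; apply: eq_bigr => i _ /=.
rewrite scaler_sumr -big_split; apply: eq_bigr => j _ /=.
by rewrite !talgE [c *: _]scalerA -scalerDl mulrA mulrDl.
Qed.

Lemma tlmulR x : linmap (tlmul x).
Proof.
move=> c y y'; rewrite /tlmul scaler_sumr -big_split; apply: eq_bigr => i _ /=.
rewrite scaler_sumr -big_split; apply: eq_bigr => j _ /=.
by rewrite !talgE [c *: _]scalerA -scalerDl mulrCA mulrDr.
Qed.

Lemma tlmul_delta i j :
  tlmul (tdelta i) (tdelta j) = d ^+ twt i j *: tdelta (tmul i j).
Proof.
rewrite /tlmul (bigD1 i) //= (bigD1 j) //= !tdeltaE !eqxx mulr1 scale1r.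
rewrite !big1 ?addr0 //.
  by move=> k ki; rewrite big1 // => l _; rewrite tdeltaE eq_sym (negPf ki) mul0r scale0r.
by move=> l lj; rewrite !tdeltaE [j == l]eq_sym (negPf lj) mulr0 scale0r.
Qed.

Fact tlmulA : associative tlmul.
Proof.
move=> x y z.
apply: (@talg_lin_ext _ (fun x => tlmul x (tlmul y z)) (fun x => tlmul (tlmul x y) z)).
- exact: tlmulL.
- by move=> c a b; rewrite !tlmulL.
move=> i; apply: (@talg_lin_ext _ (fun y => tlmul (tdelta i) (tlmul y z))
                                 (fun y => tlmul (tlmul (tdelta i) y) z)).
- by move=> c a b; rewrite tlmulL tlmulR.
- by move=> c a b; rewrite tlmulR tlmulL.
move=> j; apply: (@talg_lin_ext _ (fun z => tlmul (tdelta i) (tlmul (tdelta j) z))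
                                 (fun z => tlmul (tlmul (tdelta i) (tdelta j)) z)).
- by move=> c a b; rewrite !tlmulR.
- by move=> c a b; rewrite !tlmulR.
(* On basis elements the exponents agree by the cocycle identity, the products by associativity in
   the monoid. *)
move=> k; rewrite !tlmul_delta (linmapZ (tlmulR _)) (linmapZ (tlmulL _)).
by rewrite !tlmul_delta !scalerA -!exprD twtA tmulA.
Qed.

Fact tlmul1x : left_id (tdelta (tone m)) tlmul.
Proof.
apply: talg_lin_ext => [||i]; [exact: tlmulR | by [] |].
by rewrite tlmul_delta twt1m tmul1m scale1r.
Qed.

Fact tlmulx1 : right_id (tdelta (tone m)) tlmul.
Proof.
apply: talg_lin_ext => [||i]; [exact: tlmulL | by [] |].
by rewrite tlmul_delta twtm1 tmulm1 scale1r.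
Qed.

Fact tlmulDl : left_distributive tlmul +%R.
Proof. by move=> x y z; rewrite (linmapD (tlmulL z)). Qed.
Fact tlmulDr : right_distributive tlmul +%R.
Proof. by move=> x y z; rewrite (linmapD (tlmulR x)). Qed.

Fact tone_neq0 : tdelta (tone m) != 0.
Proof.
apply/eqP => /talgP/(_ (tone m))/eqP.
by rewrite tdeltaE eqxx talgE oner_eq0.
Qed.

HB.instance Definition _ := GRing.Zmodule_isNzRing.Build T
  tlmulA tlmul1x tlmulx1 tlmulDl tlmulDr tone_neq0.

Fact tscaleAl (c : R) (x y : T) : c *: (x * y) = (c *: x) * y.
Proof. by rewrite /GRing.mul /= (linmapZ (tlmulL y)). Qed.
HB.instance Definition _ := GRing.Lmodule_isLalgebra.Build R T tscaleAl.
Fact tscaleAr (c : R) (x y : T) : c *: (x * y) = x * (c *: y).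
Proof. by rewrite /GRing.mul /= (linmapZ (tlmulR x)). Qed.
HB.instance Definition _ := GRing.Lalgebra_isAlgebra.Build R T tscaleAr.

Lemma tdeltaM i j : tdelta i * tdelta j = d ^+ twt i j *: tdelta (tmul i j).
Proof. exact: tlmul_delta. Qed.

Lemma tdelta1 : tdelta (tone m) = 1.
Proof. by []. Qed.

(* The linear extension of a permutation [s] of the basis; as a substitution
   of coordinates this is correct only for involutive [s]. *)
Definition tflip (s : m -> m) (x : T) : T := [ffun i => x (s i)].

Lemma tflipE s x i : tflip s x i = x (s i).
Proof. by rewrite ffunE. Qed.

Lemma tflipL s : linmap (tflip s).
Proof. by move=> c x y; apply/talgP => i; rewrite !(tflipE, talgE). Qed.

Lemma tflip_delta s i : involutive s -> tflip s (tdelta i) = tdelta (s i).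
Proof.
move=> sK; apply/talgP => j; rewrite tflipE !tdeltaE.
by rewrite (can2_eq sK sK).
Qed.

Lemma tflip_anti s : involutive s ->
  (forall i j, s (tmul i j) = tmul (s j) (s i)) ->
  (forall i j, twt (s j) (s i) = twt i j) -> anti_involution (tflip s).
Proof.
move=> sK sM sW; split; first exact: tflipL.
- move=> x y; move: x.
  apply: talg_lin_ext => [c a b|c a b|i].
  + by rewrite mulrDl -scalerAl tflipL.
  + by rewrite tflipL mulrDr -scalerAr.
  move: y; apply: talg_lin_ext => [c a b|c a b|j].
  + by rewrite mulrDr -scalerAr tflipL.
  + by rewrite tflipL mulrDl -scalerAl.
  by rewrite tdeltaM (linmapZ (tflipL s)) !tflip_delta // tdeltaM sM sW.
- by move=> x; apply/talgP => i; rewrite !tflipE sK.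
Qed.

End TwistedMonoidAlgebra.

(** * Integral cell data *)

(** The index sets are nonempty by construction, so [ord0] can serve as a reference index. *)
Definition ord_family (n : nat) (sz : 'I_n -> nat) (lam : 'I_n) : finType :=
  'I_(sz lam).+1.

Definition mkcell (n : nat) (sz : 'I_n -> nat) (lam : 'I_n)
    (s t : 'I_(sz lam).+1) : cell_idx (ord_family sz) :=
  @existT 'I_n (fun l => (ord_family sz l * ord_family sz l)%type) lam (s, t).
Arguments mkcell {n sz} lam s t.

Section IntegralCellDatum.
Variables (R : fieldType) (d : R) (m : tmonoid) (flip : m -> m).
Variables (n : nat) (sz : 'I_n -> nat).
Local Notation M := (ord_family sz).
Local Notation I := (cell_idx M).
Local Notation cell := (@mkcell n sz).
(** [T i] lists the coordinates of a cell basis element and [S i] is the dual functional. With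
    integer entries both can be tested by evaluation and then mapped to [R]. *)
Variables T S : I -> m -> int.

(* The coefficient of the cell basis element [i'] in [g * i]. *)
Definition cell_coef (g : m) (i i' : I) : int := \sum_b T i b * S i' (tmul g b).

Hypothesis wt0 : forall x y : m, twt x y = 0%N.
Hypothesis flip_anti : anti_involution (tflip (d := d) flip).
Hypothesis ST : forall b b', \sum_i S i b * T i b' = (b == b')%:R.
Hypothesis TS : forall i i', \sum_b T i b * S i' b = (i == i')%:R.
Hypothesis Tflip : forall lam s t b, T (cell lam s t) (flip b) = T (cell lam t s) b.
(** The cell axiom on coefficients: apart from strictly lower cells, only elements with the same
    second index [t] occur, and their coefficients can be read off at [ord0]. *)
Hypothesis Tmul : forall g lam (s t : 'I_(sz lam).+1) (i' : I), ((lam : nat) <= tag i')%N ->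
  cell_coef g (cell lam s t) i' =
  \sum_s' (i' == cell lam s' t)%:R
          * cell_coef g (cell lam s ord0) (cell lam s' ord0).

Local Notation C i := ([ffun b => (T i b)%:~R] : talg d m).

Lemma intr_natE (k : nat) : k%:R = (k%:R : int)%:~R :> R.
Proof. by rewrite (rmorph_nat (intmul 1)). Qed.

Lemma cell_coordE (x : talg d m) : x = \sum_i (\sum_b x b * (S i b)%:~R) *: C i.
Proof.
apply/talgP => b'; rewrite talgE.
under eq_bigr => i _ do rewrite talgE ffunE big_distrl /=.
rewrite exchange_big /= -[LHS](_ : \sum_b x b * (b == b')%:R = _); last first.
  rewrite (bigD1 b') //= eqxx mulr1 big1 ?addr0 // => b /negPf ->.
  by rewrite mulr0.
apply: eq_bigr => b _; rewrite intr_natE -ST raddf_sum mulr_sumr.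
by apply: eq_bigr => i _; rewrite /= rmorphM mulrA.
Qed.

Lemma cell_free (c : I -> R) : \sum_i c i *: C i = 0 -> forall i, c i = 0.
Proof.
move=> c0 i'; transitivity (\sum_i c i * (i == i')%:R).
  rewrite (bigD1 i') //= eqxx mulr1 big1 ?addr0 // => i /negPf ->.
  by rewrite mulr0.
transitivity (\sum_b (\sum_i c i *: C i) b * (S i' b)%:~R); last first.
  by rewrite c0 big1 // => b _; rewrite talgE mul0r.
under [RHS]eq_bigr => b _ do rewrite talgE big_distrl /=.
rewrite exchange_big /=; apply: eq_bigr => i _.
rewrite intr_natE -TS raddf_sum mulr_sumr.
by apply: eq_bigr => b _; rewrite /= rmorphM mulrA talgE ffunE.
Qed.

Lemma cell_coef_mul (a : talg d m) i i' :
  \sum_b (a * C i) b * (S i' b)%:~R = \sum_g a g * (cell_coef g i i')%:~R.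
Proof.
(* The pairing with [S i'] takes values in [R^o], so that the lemmas on linear maps apply to it. *)
pose f (x : talg d m) : R^o := \sum_b x b * (S i' b)%:~R.
have fL : linmap f.
  move=> c x y; rewrite /f scaler_sumr -big_split; apply: eq_bigr => b _ /=.
  by rewrite !talgE mulrDl -mulrA.
have fd k : f (tdelta d k) = (S i' k)%:~R.
  rewrite /f (bigD1 k) //= tdeltaE eqxx mul1r big1 ?addr0 // => b.
  by rewrite tdeltaE eq_sym => /negPf ->; rewrite mul0r.
change (f (a * C i) = \sum_g a g * (cell_coef g i i')%:~R).
rewrite {1}(talg_basis a) mulr_suml (linmap_sum fL); apply: eq_bigr => g _.
rewrite -scalerAl (linmapZ fL); congr (_ * _).
rewrite [X in _ * X](talg_basis) mulr_sumr (linmap_sum fL) raddf_sum.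
apply: eq_bigr => b _ /=; rewrite -scalerAr (linmapZ fL) ffunE tdeltaM wt0 scale1r.
by rewrite fd rmorphM.
Qed.

Lemma cellular_integral : cellular (tflip (d := d) flip).
Proof.
split=> //; exists 'I_n, (fun x y : 'I_n => x <= y)%N, M, (fun i => C i) => Cb lower.
split.
- split=> [x|x y xy yx|x y z]; [exact: leqnn | | exact: leq_trans].
  by apply/val_inj/eqP; rewrite eqn_leq xy yx.
- by move=> x; exists (fun i => \sum_b x b * (S i b)%:~R); apply: cell_coordE.
- exact: cell_free.
- by move=> lam s t; apply/talgP => b; rewrite tflipE !ffunE Tflip.
move=> a lam s.
(* The structure constants are taken at the reference index [ord0], which makes them independent of
   [t]. *)
pose r s' : R := \sum_g a g * (cell_coef g (cell lam s ord0) (cell lam s' ord0))%:~R.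
exists r => t.
(* [c] holds the true coordinates of the product and [c'] the predicted ones; they agree on every
   cell whose index is at least [lam]. *)
pose c i' : R := \sum_g a g * (cell_coef g (cell lam s t) i')%:~R.
exists c; pose c' (i' : I) : R := \sum_s' (i' == cell lam s' t)%:R * r s'.
have cc' (i' : I) : (lam <= tag i')%N -> c i' = c' i'.
  move=> le_lam; rewrite /c /c'.
  under eq_bigr => g _ do rewrite Tmul // raddf_sum mulr_sumr.
  rewrite exchange_big; apply: eq_bigr => s' _ /=.
  rewrite /r mulr_sumr; apply: eq_bigr => g _; rewrite rmorphM /=.
  by rewrite -intr_natE mulrCA.
have -> : a * Cb lam s t = \sum_i c i *: C i.
  by rewrite {1}(cell_coordE (a * _)); apply: eq_bigr => i _; rewrite cell_coef_mul.
have -> : \sum_s' r s' *: Cb lam s' t = \sum_i c' i *: C i.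
  transitivity (\sum_s' \sum_i ((i == cell lam s' t)%:R * r s') *: C i).
    apply: eq_bigr => s' _; rewrite (bigD1 (cell lam s' t)) //= eqxx mul1r.
    by rewrite big1 ?addr0 // => i /negPf ->; rewrite mul0r scale0r.
  by rewrite exchange_big; apply: eq_bigr => i _; rewrite scaler_suml.
rewrite -sumrB (bigID (fun i : I => ((tag i : 'I_n) <= lam)%N && (tag i != lam))) /=.
rewrite [X in _ + X]big1 ?addr0; last first.
  move=> i; rewrite -[tag i != lam]/(val (tag i) != val lam).
  rewrite andbC -ltn_neqAle -leqNgt => /cc' ->.
  by rewrite subrr.
(* Strictly below [lam] the predicted coordinates vanish, so [c] itself witnesses [lower]. *)
apply: eq_bigr => i /andP[_ nlam]; rewrite -scalerBl [c' i]big1 ?subr0 // => s' _.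
case: eqP => [E|]; last by rewrite mul0r.
by rewrite E eqxx in nlam.
Qed.

End IntegralCellDatum.

(** * Monoids and cell data given by tables *)

Section NatTables.
Local Open Scope nat_scope.

(** Bounded quantification over [nat] as a boolean, so that finite checks reduce by evaluation. *)
Definition all_lt (n : nat) (P : pred nat) : bool := all P (iota 0 n).

Lemma all_ltP n (P : pred nat) : reflect (forall i, i < n -> P i) (all_lt n P).
Proof.
apply: (iffP allP) => h i; first by move=> lt_in; apply: h; rewrite mem_iota.
by rewrite mem_iota; apply: h.
Qed.

Lemma all_ordP n (P : pred nat) : reflect (forall i : 'I_n, P i) (all_lt n P).
Proof.
apply: (iffP (all_ltP _ _)) => h i; first exact: h.
by move=> lt_in; apply: (h (Ordinal lt_in)).
Qed.

Variables (n : nat) (one : nat) (mul wt : nat -> nat -> nat) (flip : nat -> nat).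
Local Notation T := 'I_n.+1.

Definition tmonoid_check : bool :=
  (one < n.+1) && all_lt n.+1 (fun i =>
    [&& mul one i == i, mul i one == i, wt one i == 0, wt i one == 0
      & all_lt n.+1 (fun j => (mul i j < n.+1) && all_lt n.+1 (fun k =>
          (mul i (mul j k) == mul (mul i j) k) &&
          (wt i j + wt (mul i j) k == wt j k + wt i (mul j k))))]).

Definition flip_check : bool :=
  all_lt n.+1 (fun i => [&& flip i < n.+1, flip (flip i) == i
    & all_lt n.+1 (fun j => (flip (mul i j) == mul (flip j) (flip i)) &&
                            (wt (flip j) (flip i) == wt i j))]).

Hypothesis monT : tmonoid_check.
Hypothesis flipT : flip_check.

Let oneP : one < n.+1. Proof. by case/andP: monT. Qed.
Let unitP (i : T) : [/\ mul one i = i, mul i one = i, wt one i = 0 & wt i one = 0].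
Proof.
case/andP: monT => _ /all_ordP/(_ i)/and5P[/eqP-> /eqP-> /eqP-> /eqP-> _].
by split.
Qed.
Let mul_lt (i j : T) : mul i j < n.+1.
Proof. by case/andP: monT => _ /all_ordP/(_ i)/and5P[_ _ _ _ /all_ordP/(_ j)/andP[]]. Qed.
Let assocP (i j k : T) : mul i (mul j k) = mul (mul i j) k /\
  wt i j + wt (mul i j) k = wt j k + wt i (mul j k).
Proof.
case/andP: monT => _ /all_ordP/(_ i)/and5P[_ _ _ _ /all_ordP/(_ j)/andP[_]].
by move=> /all_ordP/(_ k)/andP[/eqP-> /eqP->].
Qed.

(** The default value of [inord] never occurs, because [tmonoid_check] includes the range bounds. *)
Definition ord_mul (i j : T) : T := inord (mul i j).
Definition ord_wt (i j : T) : nat := wt i j.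
Definition ord_one : T := inord one.
Definition ord_flip (i : T) : T := inord (flip i).

Lemma ord_mulE i j : ord_mul i j = mul i j :> nat.
Proof. by rewrite inordK. Qed.
Lemma ord_oneE : ord_one = one :> nat.
Proof. by rewrite inordK. Qed.

Fact ord_mulA i j k : ord_mul i (ord_mul j k) = ord_mul (ord_mul i j) k.
Proof. by apply/val_inj; rewrite /= !ord_mulE; case: (assocP i j k). Qed.
Fact ord_mul1 i : ord_mul ord_one i = i.
Proof. by apply/val_inj; rewrite /= ord_mulE ord_oneE; case: (unitP i). Qed.
Fact ord_mulr1 i : ord_mul i ord_one = i.
Proof. by apply/val_inj; rewrite /= ord_mulE ord_oneE; case: (unitP i). Qed.
Fact ord_wtA i j k : ord_wt i j + ord_wt (ord_mul i j) k =
  ord_wt j k + ord_wt i (ord_mul j k).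
Proof. by rewrite /ord_wt !ord_mulE; case: (assocP i j k). Qed.
Fact ord_wt1 i : ord_wt ord_one i = 0.
Proof. by rewrite /ord_wt ord_oneE; case: (unitP i). Qed.
Fact ord_wtr1 i : ord_wt i ord_one = 0.
Proof. by rewrite /ord_wt ord_oneE; case: (unitP i). Qed.

Definition ord_tmonoid : tmonoid :=
  TMonoid ord_mulA ord_mul1 ord_mulr1 ord_wtA ord_wt1 ord_wtr1.

Let flipP (i : T) : flip i < n.+1 /\ flip (flip i) = i.
Proof. by case/all_ordP/(_ i)/and3P: flipT => -> /eqP-> _. Qed.

Lemma ord_flipE i : ord_flip i = flip i :> nat.
Proof. by rewrite inordK //; case: (flipP i). Qed.

Lemma ord_flipK : involutive ord_flip.
Proof. by move=> i; apply/val_inj; rewrite /= !ord_flipE; case: (flipP i). Qed.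

Lemma ord_flip_anti (R : fieldType) (d : R) :
  anti_involution (@tflip R d ord_tmonoid ord_flip).
Proof.
apply: tflip_anti => [|i j|i j]; first exact: ord_flipK.
  apply/val_inj; rewrite /= ord_flipE !ord_mulE !ord_flipE.
  by case/all_ordP/(_ i)/and3P: flipT => _ _ /all_ordP/(_ j)/andP[/eqP].
rewrite /= /ord_wt !ord_flipE.
by case/all_ordP/(_ i)/and3P: flipT => _ _ /all_ordP/(_ j)/andP[_ /eqP].
Qed.

Variables (sizes : seq nat) (vec dual : nat -> nat -> int).

Definition cell_size (lam : nat) : nat := nth 0 sizes lam.

Definition cell_coords : seq (nat * nat * nat) :=
  flatten [seq [seq (lam, s, t) | s <- iota 0 (cell_size lam).+1,
                                 t <- iota 0 (cell_size lam).+1]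
          | lam <- iota 0 (size sizes)].
Definition cell_pos (lam s t : nat) : nat := index (lam, s, t) cell_coords.

(** A plain fold, so that integer sums evaluate; [sum_iotaE] returns to big operators. *)
Definition sum_iota (m : nat) (F : nat -> int) : int :=
  foldr (fun i z => F i + z)%R 0%R (iota 0 m).

Lemma sum_iotaE m F : sum_iota m F = (\sum_(i < m) F i)%R.
Proof.
rewrite -(big_mkord xpredT) /index_iota subn0 /sum_iota.
by elim: (iota 0 m) => [|i r IH]; rewrite ?big_nil // big_cons /= IH.
Qed.

Definition nat_coef (g k k' : nat) : int :=
  sum_iota n.+1 (fun b => vec k b * dual k' (mul g b))%R.

Definition all_cells (P : nat -> nat -> nat -> bool) : bool :=
  all_lt (size sizes) (fun lam => all_lt (cell_size lam).+1 (fun s =>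
    all_lt (cell_size lam).+1 (fun t => P lam s t))).

(** The sum of squares is the dimension count. With injectivity of the positions it makes the
    numbering of cell indices bijective. *)
Definition cell_pos_check : bool :=
  (sumn [seq m.+1 ^ 2 | m <- sizes] == n.+1) &&
  all_cells (fun lam s t => (cell_pos lam s t < n.+1) &&
    (nth (0, 0, 0) cell_coords (cell_pos lam s t) == (lam, s, t))).

Definition cell_dual_check : bool :=
  all_lt n.+1 (fun b => all_lt n.+1 (fun b' =>
    (sum_iota n.+1 (fun k => dual k b * vec k b')%R == (b == b')%:R%R) &&
    (sum_iota n.+1 (fun k => vec b k * dual b' k)%R == (b == b')%:R%R))).

Definition cell_flip_check : bool :=
  all_cells (fun lam s t => all_lt n.+1 (fun b =>
    vec (cell_pos lam s t) (flip b) == vec (cell_pos lam t s) b)).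

Definition cell_mul_check : bool :=
  all_cells (fun lam s t => all_cells (fun lam' s' t' =>
    (lam <= lam') ==> all_lt n.+1 (fun g =>
      nat_coef g (cell_pos lam s t) (cell_pos lam' s' t') ==
      if (lam' == lam) && (t' == t) then
        nat_coef g (cell_pos lam s 0) (cell_pos lam s' 0)
      else 0%R))).

Hypothesis wt0 : forall i j, wt i j = 0.
Hypothesis posT : cell_pos_check.
Hypothesis dualT : cell_dual_check.
Hypothesis vec_flipT : cell_flip_check.
Hypothesis vec_mulT : cell_mul_check.

Let sz (lam : 'I_(size sizes)) : nat := cell_size lam.
Local Notation I := (cell_idx (ord_family sz)).

Let cell_ord (i : I) : T :=
  inord (cell_pos (tag i : 'I_(size sizes)) ((tagged i).1 : 'I_(sz (tag i)).+1)
                  ((tagged i).2 : 'I_(sz (tag i)).+1)).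

Let all_cellsP P : all_cells P ->
  forall (lam : 'I_(size sizes)) (s t : 'I_(sz lam).+1), P lam s t.
Proof.
move=> /all_ordP h lam s t.
by move: (h lam) => /all_ordP/(_ s)/all_ordP/(_ t).
Qed.

Let cell_posP (lam : 'I_(size sizes)) (s t : 'I_(sz lam).+1) :
  cell_pos lam s t < n.+1 /\
  nth (0, 0, 0) cell_coords (cell_pos lam s t) = (lam : nat, s : nat, t : nat).
Proof.
by case/andP: posT => _ /all_cellsP/(_ lam s t)/andP[-> /eqP->].
Qed.

Let cell_ordE (lam : 'I_(size sizes)) (s t : 'I_(sz lam).+1) :
  cell_ord (mkcell lam s t) = cell_pos lam s t :> nat.
Proof. by rewrite /cell_ord /= inordK //; case: (cell_posP s t). Qed.

Let cell_ord_inj : injective cell_ord.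
Proof.
move=> [lam [s t]] [lam' [s' t']] /(congr1 val).
rewrite [LHS](cell_ordE s t) [RHS](cell_ordE s' t') => E.
have [_] := cell_posP s t; rewrite E.
have [_ ->] := cell_posP s' t'; case=> /val_inj El; subst lam'.
by move=> /val_inj -> /val_inj ->.
Qed.

Let cell_ord_bij : bijective cell_ord.
Proof.
apply: inj_card_bij cell_ord_inj _; rewrite card_ord card_tagged.
case/andP: posT => /eqP<- _.
rewrite (_ : map _ _ = [seq m.+1 ^ 2 | m <- sizes]) //.
rewrite -[in RHS](mkseq_nth 0 sizes) /mkseq -map_comp -val_enum_ord -map_comp.
by apply: eq_map => lam; rewrite /= card_prod !card_ord.
Qed.

Lemma ord_cellular (R : fieldType) (d : R) :
  cellular (@tflip R d ord_tmonoid ord_flip).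
Proof.
pose V (i : I) (b : T) := vec (cell_ord i) b.
pose W (i : I) (b : T) := dual (cell_ord i) b.
have coefE (g : T) (i i' : I) : @cell_coef ord_tmonoid _ sz V W g i i' =
    nat_coef g (cell_ord i) (cell_ord i').
  rewrite /nat_coef sum_iotaE; apply: eq_bigr => b _; rewrite /V /W.
  by rewrite -ord_mulE.
have sumE (F : nat -> int) : (\sum_(i : I) F (cell_ord i) = sum_iota n.+1 F)%R.
  by rewrite sum_iotaE [RHS](reindex cell_ord) //; apply: onW_bij.
apply: (@cellular_integral R d ord_tmonoid ord_flip _ sz V W).
- by move=> x y; apply: wt0.
- exact: ord_flip_anti.
- move=> b b'; rewrite /V /W (sumE (fun k => dual k b * vec k b')%R).
  by case/all_ordP/(_ b)/all_ordP/(_ b')/andP: dualT => /eqP-> _.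
- move=> i i'; rewrite -(inj_eq cell_ord_inj).
  case/all_ordP/(_ (cell_ord i))/all_ordP/(_ (cell_ord i'))/andP: dualT => _.
  by rewrite sum_iotaE => /eqP.
- move=> lam s t b; rewrite /V !cell_ordE ord_flipE.
  by have /all_cellsP/(_ lam s t)/all_ordP/(_ b)/eqP := vec_flipT.
move=> g lam s t [lam' [s' t']] /= le_lam.
rewrite coefE cell_ordE [X in nat_coef _ _ X](cell_ordE s' t').
have /all_cellsP/(_ lam s t)/all_cellsP/(_ lam' s' t') := vec_mulT.
rewrite le_lam /= => /all_ordP/(_ g)/eqP->.
(* In a different cell every summand vanishes because the tags differ; in the same cell only
   [s'' = s'] can contribute. *)
have [E|neq] /= := eqVneq (lam' : nat) (lam : nat); last first.
  rewrite big1 // => s'' _; case: eqP => [E|_]; last by rewrite mul0r.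
  by move: neq; rewrite (congr1 tag E : lam' = lam) eqxx.
move/val_inj: E => E; subst lam'.
rewrite (bigD1 s') //= big1 ?addr0; last first.
  move=> s'' ns; rewrite eq_Tagged /= [_ == _](_ : _ = false) ?mul0r //.
  by apply/negP => /eqP[E]; rewrite E eqxx in ns.
rewrite eq_Tagged /= coefE !cell_ordE -[(s', t') == _]/((s' == s') && (t' == t)).
rewrite eqxx /= -[t' == t]/((t' : nat) == (t : nat)).
by case: ifP; rewrite ?mul1r ?mul0r.
Qed.

End NatTables.

(** * Monoids with a layered basis *)

Section LayeredMonoid.
Variables (R : fieldType) (d : R) (m : tmonoid) (flip : m -> m).
Variables (n : nat) (G : 'I_n -> tmonoid) (gflip : forall l, G l -> G l).
Variables (D : 'I_n -> nat) (lay : m -> 'I_n).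
Variables (row col : forall l, m -> 'I_(D l).+1) (grp : forall l, m -> G l).
Variable pos : forall l, 'I_(D l).+1 -> 'I_(D l).+1 -> G l -> m.
Variable idem_wt : 'I_n -> nat.

Local Notation A := (talg d m).
Local Notation B l := (talg d (G l)).
Local Notation mxl l := (matrix (B l) (D l).+1 (D l).+1).
Local Notation colpos l i := (pos (l := l) i ord0 (tone (G l))).
Local Notation rowpos l j := (pos (l := l) ord0 j (tone (G l))).

Hypothesis d_neq0 : d != 0.
Hypothesis posK : forall l k, lay k = l -> pos (row l k) (col l k) (grp l k) = k.
Hypothesis lay_pos : forall l i j (b : G l), lay (pos i j b) = l.
Hypothesis row_pos : forall l i j (b : G l), row l (pos i j b) = i.
Hypothesis col_pos : forall l i j (b : G l), col l (pos i j b) = j.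
Hypothesis grp_pos : forall l i j (b : G l), grp l (pos i j b) = b.
Hypothesis lay_mul : forall x y : m,
  (lay (tmul x y) <= lay x)%N /\ (lay (tmul x y) <= lay y)%N.
Hypothesis gwt0 : forall l (b b' : G l), twt b b' = 0%N.
Hypothesis gcell : forall l, cellular (@tflip R d (G l) (@gflip l)).
Hypothesis gflipK : forall l, involutive (@gflip l).
Hypothesis flip_anti : anti_involution (@tflip R d m flip).
Hypothesis lay_flip : forall k, lay (flip k) = lay k.
Hypothesis row_flip : forall l k, lay k = l -> row l (flip k) = col l k.
Hypothesis col_flip : forall l k, lay k = l -> col l (flip k) = row l k.
Hypothesis grp_flip : forall l k, lay k = l -> grp l (flip k) = gflip (grp l k).

(** For a given row, the effect of [p] is determined on the first column: either the row changes and
    the group part is multiplied from the left, or the product drops to a strictly lower layer. *)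
Hypothesis left_action : forall l p i j (b : G l),
  let s0 := tmul p (colpos l i) in let s := tmul p (pos i j b) in
  (lay s0 = l /\ s = pos (row l s0) j (tmul (grp l s0) b) /\
     twt p (pos i j b) = twt p (colpos l i)) \/
  (lay s0 <> l /\ (lay s < l)%N).

(** Whether the product stays in the layer, and with which group factor and exponent, depends only
    on the inner pair [(j, i')]; hence the product is governed by a bilinear form. *)
Hypothesis form : forall l i j (b : G l) i',
  let s0 := tmul (rowpos l j) (colpos l i') in
  let s := tmul (pos i j b) (colpos l i') in
  (lay s0 = l /\ [/\ lay s = l, row l s = i, grp l s = tmul b (grp l s0) &
     twt (pos i j b) (colpos l i') = twt (rowpos l j) (colpos l i')]) \/
  (lay s0 <> l /\ lay s <> l).

Hypothesis form_flip : forall l i j,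
  let s := tmul (rowpos l i) (colpos l j) in
  let s' := tmul (rowpos l j) (colpos l i) in
  [/\ lay s = lay s', lay s = l -> grp l s = gflip (grp l s') &
      twt (rowpos l i) (colpos l j) = twt (rowpos l j) (colpos l i)].

(** For [l' = l] this gives an idempotent up to a power of [d]. The same power occurs on lower
    layers, so one scalar normalises both. *)
Hypothesis idem_mul : forall l l' : 'I_n, (l' <= l)%N ->
  let e := colpos l ord0 in let e' := colpos l' ord0 in
  [/\ tmul e e' = e', tmul e' e = e', twt e e' = idem_wt l & twt e' e = idem_wt l].

Definition lform l : mxl l := \matrix_(j, i)
  let s := tmul (rowpos l j) (colpos l i) in
  if lay s == l then d ^+ twt (rowpos l j) (colpos l i) *: tdelta d (grp l s) else 0.

Definition mlayer l : layer R :=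
  @Layer R (B l : algType R) (@tflip R d (G l) (@gflip l)) (D l).+1 (lform l).

Definition lembed l (M : 'M[lB (mlayer l)]_(ld (mlayer l))) : A :=
  let M' : mxl l := M in
  [ffun k => if lay k == l then M' (row l k) (col l k) (grp l k) else 0].

Definition lcoord l (x : A) : mxl l :=
  \matrix_(i, j) [ffun b => x (pos i j b)].

Lemma lembedE l (M : mxl l) k :
  lembed (l := l) M k = if lay k == l then M (row l k) (col l k) (grp l k) else 0.
Proof. by rewrite ffunE. Qed.

Lemma lcoordE l x i j b : lcoord l x i j b = x (pos i j b).
Proof. by rewrite mxE ffunE. Qed.

Lemma lembedK l (M : mxl l) : lcoord l (lembed (l := l) M) = M.
Proof.
apply/matrixP => i j; apply/talgP => b; rewrite lcoordE lembedE.
by rewrite lay_pos eqxx row_pos col_pos grp_pos.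
Qed.

Lemma lembed_lcoord l x k : lembed (l := l) (lcoord l x) k =
  if lay k == l then x k else 0.
Proof. by rewrite lembedE; case: eqP => // E; rewrite lcoordE posK. Qed.

Lemma lembedD l M N : lembed (l := l) (M + N) = lembed M + lembed N.
Proof.
apply/talgP => k; rewrite talgE !lembedE; case: ifP; rewrite ?addr0 //.
by rewrite mxE talgE.
Qed.

Lemma lembedZ l c M : lembed (l := l) (mx_scale c M) = c *: lembed M.
Proof.
apply/talgP => k; rewrite talgE !lembedE; case: ifP; rewrite ?mulr0 //.
by rewrite mxE talgE.
Qed.

Lemma lcoordL l i j : linmap (fun x => lcoord l x i j).
Proof. by move=> c x y; apply/talgP => b; rewrite !(talgE, lcoordE). Qed.

Lemma lcoord_delta l q i j : lcoord l (tdelta d q) i j =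
  if [&& lay q == l, i == row l q & j == col l q] then tdelta d (grp l q) else 0.
Proof.
apply/talgP => b; rewrite lcoordE tdeltaE.
case: (eqVneq q) => [->|nq].
  by rewrite lay_pos row_pos col_pos grp_pos !eqxx tdeltaE eqxx.
case: ifP; last by rewrite talgE.
case/and3P=> /eqP lq /eqP Ei /eqP Ej; rewrite tdeltaE; case: eqP => // Eb.
by rewrite -Eb Ei Ej posK // eqxx in nq.
Qed.

Lemma sum_lembedE (P : pred 'I_n)
    (M : forall l : 'I_n, 'M[lB (mlayer l)]_(ld (mlayer l))) k :
  (\sum_(l | P l) lembed (M l)) k = if P (lay k) then lembed (M (lay k)) k else 0.
Proof.
rewrite talgE; case: ifP => Pk.
  rewrite (bigD1 (lay k)) //= big1 ?addr0 // => l /andP[_ nl].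
  by rewrite lembedE eq_sym (negPf nl).
rewrite big1 // => l Pl; rewrite lembedE; case: eqP => // E.
by rewrite E Pl in Pk.
Qed.

(** The layers partition the basis, so membership in a partial sum is a condition on the support. *)
Lemma layers_leP l x :
  layers_le lembed l x <-> forall k, (l < lay k)%N -> x k = 0.
Proof.
split=> [[M ->] k lk|h]; first by rewrite sum_lembedE leqNgt lk.
exists (fun l => lcoord l x); apply/talgP => k; rewrite sum_lembedE.
by case: leqP => [_|/h//]; rewrite lembed_lcoord eqxx.
Qed.

Lemma layers_ltP l x :
  layers_lt lembed l x <-> forall k, (l <= lay k)%N -> x k = 0.
Proof.
split=> [[M ->] k lk|h]; first by rewrite sum_lembedE ltnNge lk.
exists (fun l => lcoord l x); apply/talgP => k; rewrite sum_lembedE.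
by case: ltnP => [_|/h//]; rewrite lembed_lcoord eqxx.
Qed.

Lemma talg_supp_mul (x y : A) k :
  (forall i j, tmul i j = k -> x i * y j = 0) -> (x * y) k = 0.
Proof.
move=> h; rewrite (talg_basis x) (talg_basis y) mulr_suml talgE big1 // => i _.
rewrite mulr_sumr talgE big1 // => j _.
rewrite -scalerAl -scalerAr tdeltaM !talgE tdeltaE.
case: eqP => [/h|_]; last by rewrite !mulr0.
by rewrite mulrA => ->; rewrite mul0r.
Qed.

(** The matrix by which [a] acts on layer [l] modulo lower layers; it collects the products with the
    first column that stay in the layer. *)
Definition lact l (a : A) : mxl l := \matrix_(i', i)
  \sum_p a p *: (let s := tmul p (colpos l i) in
    if (lay s == l) && (row l s == i') then
      d ^+ twt p (colpos l i) *: tdelta d (grp l s) else 0).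

Lemma lactL l i' i : linmap (fun a => lact l a i' i).
Proof.
move=> c a a'; rewrite !mxE scaler_sumr -big_split; apply: eq_bigr => p _ /=.
by rewrite scalerA -scalerDl !talgE.
Qed.

Lemma lact_delta l p i' i : lact l (tdelta d p) i' i =
  let s := tmul p (colpos l i) in
  if (lay s == l) && (row l s == i') then
    d ^+ twt p (colpos l i) *: tdelta d (grp l s) else 0.
Proof.
rewrite mxE (bigD1 p) //= tdeltaE eqxx scale1r big1 ?addr0 // => q.
by rewrite tdeltaE eq_sym => /negPf ->; rewrite scale0r.
Qed.

Lemma lact_coordE l a x k :
  lembed (l := l) (lact l a *m lcoord l x) k =
  if lay k == l then
    \sum_i (lact l a (row l k) i * lcoord l x i (col l k)) (grp l k) else 0.
Proof. by rewrite lembedE; case: ifP => // _; rewrite mxE talgE. Qed.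

(** Both sides are bilinear in [a] and [x], so [left_action] on basis elements suffices. The bound
    on [lay k] discards products falling into lower layers. *)
Lemma lact_lembed_lcoord (l : 'I_n) a x k : (l <= lay k)%N ->
  (a * lembed (l := l) (lcoord l x)) k = lembed (l := l) (lact l a *m lcoord l x) k.
Proof.
move=> lk.
have embL : linmap (fun x => lembed (l := l) (lcoord l x)).
  move=> c y z; apply/talgP => j; rewrite !(talgE, lembed_lcoord).
  by case: ifP; rewrite ?mulr0 ?addr0.
pose f a x : R^o := (a * lembed (l := l) (lcoord l x)) k.
pose g a x : R^o := lembed (l := l) (lact l a *m lcoord l x) k.
change (f a x = g a x); move: a.
apply: talg_lin_ext => [c a a'|c a a'|p].
- by rewrite /f mulrDl -scalerAl !talgE.
- rewrite /g !lact_coordE; case: ifP => _; last by rewrite scaler0 addr0.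
  rewrite scaler_sumr -big_split; apply: eq_bigr => i _.
  by rewrite lactL mulrDl -scalerAl !talgE.
move: x; apply: talg_lin_ext => [c x x'|c x x'|q].
- by rewrite /f embL mulrDr -scalerAr !talgE.
- rewrite /g !lact_coordE; case: ifP => _; last by rewrite scaler0 addr0.
  rewrite scaler_sumr -big_split; apply: eq_bigr => i _.
  by rewrite lcoordL mulrDr -scalerAr !talgE.
rewrite /f /g lact_coordE.
have [lq|nq] := eqVneq (lay q) l; last first.
  rewrite [lembed _](_ : _ = 0) ?mulr0 ?talgE; last first.
    apply/talgP => j; rewrite lembed_lcoord talgE tdeltaE.
    by case: (lay j =P l) => // lj; case: eqP => // E; rewrite E lj eqxx in nq.
  case: ifP => // _; rewrite big1 // => i _.
  by rewrite lcoord_delta (negPf nq) mulr0 talgE.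
have -> : lembed (l := l) (lcoord l (tdelta d q)) = tdelta d q.
  apply/talgP => j; rewrite lembed_lcoord tdeltaE; case: eqP => // nj.
  by case: eqP => // E; rewrite -E in nj.
rewrite (bigD1 (row l q)) //= big1 ?addr0; last first.
  by move=> i /negPf ni; rewrite lcoord_delta ni andbF mulr0 talgE.
rewrite lcoord_delta lq !eqxx /= lact_delta tdeltaM talgE tdeltaE.
have /= := left_action p (row l q) (col l q) (grp l q); rewrite posK //.
set s0 := tmul p (colpos l _); set s := tmul p q.
(* If the product drops, its layer is below [l], hence it differs from [k]. *)
case=> [[ls0 [Es Ew]]|[/eqP/negPf ls0 lts]]; last first.
  rewrite ls0 /= mul0r talgE.
  case: eqP => [E|_]; first by rewrite E ltnNge lk in lts.
  by rewrite mulr0; case: ifP => //; case: ifP => // _ _; rewrite talgE.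
rewrite ls0 eqxx Ew /=; have [E|nk] := eqVneq s k.
  rewrite -E Es lay_pos eqxx col_pos row_pos grp_pos !eqxx.
  by rewrite -scalerAl tdeltaM gwt0 scale1r talgE tdeltaE eqxx.
rewrite mulr0; case: eqP => // lk'; case: (eqVneq (row l s0)) => [Er|]; last first.
  by rewrite mul0r talgE.
case: (eqVneq (col l k)) => [Ec|]; last by rewrite mulr0 talgE.
rewrite -scalerAl tdeltaM gwt0 scale1r talgE tdeltaE.
case: eqP => [Eg|]; last by rewrite mulr0.
by rewrite Es Er -Ec Eg posK // eqxx in nk.
Qed.

(** Through this identity the multiplication rule inside a layer becomes a case of the left
    action. *)
Lemma lact_lembed l (M : mxl l) :
  lact l (lembed (l := l) M) = M *m lform l.
Proof.
rewrite -{2}(lembedK M); apply/matrixP => i' i'' /=.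
(* [M] is written through an element [x] of the algebra, which can then be arbitrary, so that linear
   extension applies. *)
transitivity (lact l (lembed (l := l) (lcoord l (lembed (l := l) M))) i' i'').
  by rewrite lembedK.
move: (lembed M) => x; rewrite [RHS]mxE.
move: x; apply: talg_lin_ext => [c x x'|c x x'|q].
- rewrite -lactL; congr (fun_of_matrix (lact l _) _ _).
  apply/talgP => j; rewrite !(talgE, lembed_lcoord).
  by case: ifP; rewrite ?mulr0 ?addr0.
- rewrite scaler_sumr -big_split; apply: eq_bigr => j _ /=.
  by rewrite lcoordL mulrDl -scalerAl.
have [lq|nq] := eqVneq (lay q) l; last first.
  rewrite [lembed _](_ : _ = 0); last first.
    apply/talgP => j; rewrite lembed_lcoord talgE tdeltaE.
    by case: (lay j =P l) => // lj; case: eqP => // E; rewrite E lj eqxx in nq.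
  rewrite (linmap0 (lactL _ _)) big1 // => j _.
  by rewrite lcoord_delta (negPf nq) mul0r.
have -> : lembed (l := l) (lcoord l (tdelta d q)) = tdelta d q.
  apply/talgP => j; rewrite lembed_lcoord tdeltaE; case: eqP => // nj.
  by case: eqP => // E; rewrite -E in nj.
rewrite (bigD1 (col l q)) //= big1 ?addr0; last first.
  by move=> j /negPf nj; rewrite lcoord_delta nj !andbF mul0r.
rewrite lcoord_delta lq !eqxx andbT lact_delta /= mxE /=.
have /= := form (row l q) (col l q) (grp l q) i''; rewrite posK //.
set s0 := tmul (rowpos l _) _; set s := tmul q _.
case=> [[ls0 [ls Er Eg Ew]]|[/eqP/negPf ls0 /eqP/negPf ls]]; last first.
  by rewrite ls ls0 mulr0.
rewrite ls ls0 !eqxx Er /= eq_sym; case: eqP => _; last by rewrite mul0r.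
by rewrite -scalerAr tdeltaM gwt0 scale1r Eg Ew.
Qed.

Lemma layered_inflation : iterated_inflation (@tflip R d m flip) lembed.
Proof.
split; first exact: gcell.
split.
  move=> l i j; rewrite !mxE /=.
  have [E Eg ->] := form_flip j i; rewrite -E.
  case: eqP => [/Eg->|_]; last by rewrite (linmap0 (tflipL _)).
  by rewrite (linmapZ (tflipL _)) tflip_delta ?gflipK //.
split; first exact: lembedD.
split; first exact: lembedZ.
split.
  move=> x; exists (fun l => lcoord l x); apply/talgP => k.
  by rewrite sum_lembedE lembed_lcoord eqxx.
split.
  move=> M M0 l; apply/matrixP => i j; apply/talgP => b.
  have := congr1 (fun x : A => x (pos i j b)) M0.
  rewrite sum_lembedE talgE lembedE lay_pos eqxx row_pos col_pos grp_pos => ->.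
  by rewrite mxE talgE.
split.
  move=> l a x /layers_leP x0; split; apply/layers_leP => k lk.
    apply: talg_supp_mul => i j E; rewrite x0 ?mulr0 // (leq_trans lk) // -E.
    by case: (lay_mul i j).
  apply: talg_supp_mul => i j E; rewrite x0 ?mul0r // (leq_trans lk) // -E.
  by case: (lay_mul i j).
split.
  move=> l M; apply/talgP => k; rewrite tflipE !lembedE lay_flip.
  case: eqP => // E; rewrite row_flip // col_flip // grp_flip //.
  by rewrite !mxE tflipE.
split.
  move=> l M N; apply/layers_ltP => k lk.
  have := lact_lembed_lcoord (lembed M) (lembed (l := l) N) lk.
  by rewrite !lembedK lact_lembed !talgE => ->; rewrite subrr.
move=> l a; exists (lact l a) => M; apply/layers_ltP => k lk.
have := lact_lembed_lcoord a (lembed (l := l) M) lk.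
by rewrite !lembedK !talgE => ->; rewrite subrr.
Qed.

Lemma layered_stratified : cellularly_stratified (@tflip R d m flip).
Proof.
split=> //.
  exists [seq tdelta d i | i <- enum m] => x.
  exists (fun i => x (nth (tone m) (enum m) i)).
  rewrite {1}(talg_basis x) -big_enum /= (big_nth (tone m)) big_mkord size_map.
  by apply: eq_bigr => i _; rewrite (nth_map (tone m)).
exists n, mlayer, lembed; split; first exact: layered_inflation.
(* [v] is the first unit vector and [u] a multiple of it, so that [e l] is the normalised
   [colpos l ord0]. *)
pose v l : 'rV[R]_(ld (mlayer l)) := delta_mx 0 (ord0 : 'I_(D l).+1).
pose u l : 'rV[R]_(ld (mlayer l)) := (d ^- idem_wt l) *: v l.
exists u, v => e.
have vn0 l : v l != 0.
  by apply/eqP => /rowP/(_ (ord0 : 'I_(D l).+1))/eqP; rewrite !mxE !eqxx oner_eq0.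
have dn0 l : d ^- idem_wt l != 0 by rewrite invr_eq0 expf_neq0.
have eE l : e l = d ^- idem_wt l *: tdelta d (colpos l ord0).
  apply/talgP => k; rewrite /e lembedE talgE tdeltaE.
  case: eqP => [lk|nk]; last first.
    by case: eqP => [E|_]; [rewrite -E lay_pos in nk | rewrite mulr0].
  rewrite mxE talgE !mxE /= -tdelta1 tdeltaE.
  case: (eqVneq _ k) => [<-|nk].
    by rewrite row_pos col_pos grp_pos !eqxx !mulr1.
  rewrite mulr0; case: (eqVneq (row l k)) => [Er|]; last by rewrite mulr0 !mul0r.
  case: (eqVneq (col l k)) => [Ec|]; last by rewrite mulr0 mul0r.
  case: eqP => [Eg|]; last by rewrite mulr0.
  by rewrite Eg -{1}Er -Ec posK // eqxx in nk.
have eM (l l' : 'I_n) : (l' <= l)%N -> e l * e l' = e l' /\ e l' * e l = e l'.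
  move=> le_l; rewrite !eE -!scalerAl -!scalerAr !tdeltaM.
  have [-> -> -> ->] := idem_mul le_l.
  rewrite !scalerA mulrAC mulVf ?mul1r ?expf_neq0 //.
  by rewrite -mulrA mulVf ?mulr1 ?expf_neq0.
split=> [l|l|l l' /ltnW]; [|by case: (eM l l (leqnn l))|exact: eM].
by split; rewrite // scaler_eq0 negb_or dn0 vn0.
Qed.

End LayeredMonoid.

(** * Words and rewriting *)

Section StratifiedIso.
Variables (R : fieldType) (A B : algType R) (f : A -> B) (g : B -> A).
Hypotheses (fH : alg_hom f) (gH : alg_hom g) (fK : cancel f g) (gK : cancel g f).

Lemma alg_hom_linmap (A' B' : algType R) (h : A' -> B') : alg_hom h -> linmap h.
Proof. by case=> hD hZ _ _ c x y; rewrite hD hZ. Qed.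

(** Layers and forms stay the same; the embeddings are composed with [g]. Partial sums of layers
    correspond under [f], by [leP] and [ltP]. *)
Lemma cellularly_stratified_iso (iota : B -> B) :
  cellularly_stratified iota -> cellularly_stratified (g \o iota \o f).
Proof.
have fL := alg_hom_linmap fH; have gL := alg_hom_linmap gH.
have [_ _ fM f1] := fH; have [_ _ gM g1] := gH.
case=> [[iL iM iK] [s sP] [n [L [th [[H1 [H2 [H3 [H4 [H5 [H6 [H7 [H8 [H9 H10]]]]]]]]]]]]]].
case=> u [v]; cbv zeta => -[uv ee em].
pose th' l M := g (th l M).
have leP l x : layers_le th' l x <-> layers_le th l (f x).
  split=> [[M E]|[M E]]; exists M; first by rewrite E -(linmap_sum gL) gK.
  by rewrite -[x]fK E (linmap_sum gL).
have ltP l x : layers_lt th' l x <-> layers_lt th l (f x).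
  split=> [[M E]|[M E]]; exists M; first by rewrite E -(linmap_sum gL) gK.
  by rewrite -[x]fK E (linmap_sum gL).
split.
- split=> [c x y|x y|x] /=; first by rewrite fL iL gL.
    by rewrite fM iM gM.
  by rewrite gK iK fK.
- exists (map g s) => x; have [c E] := sP (f x); rewrite size_map; exists c.
  rewrite -[x]fK E (linmap_sum gL); apply: eq_bigr => i _.
  by rewrite (linmapZ gL) (nth_map 0).
exists n, L, th'; split.
  split=> //; split=> //.
  split; first by move=> l M N; rewrite /th' H3 (linmapD gL).
  split; first by move=> l c M; rewrite /th' H4 (linmapZ gL).
  split.
    move=> x; have [M E] := H5 (f x); exists M.
    by rewrite -[x]fK E (linmap_sum gL).
  split.
    move=> M; rewrite -(linmap_sum gL) => /(congr1 f); rewrite gK (linmap0 fL).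
    exact: H6.
  split.
    move=> l a x /leP /(H7 l (f a)) [h1 h2].
    by split; apply/leP; rewrite fM.
  split; first by move=> l M; rewrite /= /th' gK H8.
  split.
    by move=> l M N; apply/ltP; rewrite (linmapB fL) fM !gK; apply: H9.
  move=> l a; have [P PP] := H10 l (f a); exists P => M.
  by apply/ltP; rewrite (linmapB fL) fM !gK; apply: PP.
exists u, v; split=> [//|l|l l' /em[h1 h2]]; rewrite /th' -!gM ?ee //.
by rewrite h1 h2.
Qed.

End StratifiedIso.

(** * Word rewriting with powers of the parameter *)

Definition word := seq nat.
Definition rule := (word * (nat * word))%type.

Fixpoint rewrite_head (rs : seq rule) (w : word) : option (nat * word) :=
  if rs is (l, (k, r)) :: rs' then
    if prefix l w then Some (k, r ++ drop (size l) w) else rewrite_head rs' w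
  else None.

Fixpoint rewrite_step (rs : seq rule) (w : word) : option (nat * word) :=
  if rewrite_head rs w is Some p then Some p else
  if w is x :: w' then
    if rewrite_step rs w' is Some (k, w'') then Some (k, x :: w'') else None
  else None.

(** The fuel makes the recursion structural; on exhaustion the current word is returned, which keeps
    [normalize_sound] valid for every fuel. *)
Fixpoint normalize (rs : seq rule) (fuel : nat) (w : word) : nat * word :=
  if fuel is n.+1 then
    if rewrite_step rs w is Some (k, w') then
      let (k', w'') := normalize rs n w' in ((k + k')%N, w'')
    else (0%N, w)
  else (0%N, w).

Section WordEval.
Variables (R : fieldType) (d : R) (A : algType R) (gen : nat -> A).

Definition weval (w : word) : A := \prod_(x <- w) gen x.

Definition rule_holds (rl : rule) : Prop :=
  weval rl.1 = d ^+ rl.2.1 *: weval rl.2.2.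

Lemma weval_cat w w' : weval (w ++ w') = weval w * weval w'.
Proof. exact: big_cat. Qed.

Lemma weval_cons x w : weval (x :: w) = gen x * weval w.
Proof. exact: big_cons. Qed.

Lemma weval1 x : weval [:: x] = gen x.
Proof. exact: big_seq1. Qed.

Variable rs : seq rule.
Hypothesis rsP : forall rl, rl \in rs -> rule_holds rl.

Lemma rewrite_head_sound w k w' :
  rewrite_head rs w = Some (k, w') -> weval w = d ^+ k *: weval w'.
Proof.
elim: rs rsP => //= -[l [k0 r]] rs' IH H.
case: prefixP => [[w0 ->]|_]; last first.
  by apply: IH => rl rl_rs; apply: H; rewrite inE rl_rs orbT.
case=> <- <-; rewrite drop_size_cat // !weval_cat.
by have -> := H _ (mem_head _ _); rewrite scalerAl.
Qed.

Lemma rewrite_step_sound w k w' :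
  rewrite_step rs w = Some (k, w') -> weval w = d ^+ k *: weval w'.
Proof.
elim: w k w' => [|x w IH] k w' /=; case E: (rewrite_head rs _) => [p|//].
- by case=> E'; apply: rewrite_head_sound; rewrite E E'.
- by case=> E'; apply: rewrite_head_sound; rewrite E E'.
case E': (rewrite_step rs w) => [[k1 w1]|//] [<- <-].
by rewrite !weval_cons (IH _ _ E') scalerAr.
Qed.

Lemma normalize_sound n w :
  weval w = d ^+ (normalize rs n w).1 *: weval (normalize rs n w).2.
Proof.
elim: n w => [|n IH] w /=; first by rewrite scale1r.
case E: (rewrite_step rs w) => [[k w']|]; last by rewrite scale1r.
rewrite (rewrite_step_sound E) (IH w'); case: (normalize rs n w') => k' w'' /=.
by rewrite scalerA exprD.
Qed.

End WordEval.

Lemma eq_weval (R : fieldType) (A : algType R) (gen gen' : nat -> A) :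
  gen =1 gen' -> weval gen =1 weval gen'.
Proof. by move=> E w; apply: eq_bigr. Qed.

(** * Algebra maps defined by words *)

Section MonoidOfWords.
Variables (R : fieldType) (d : R) (m : tmonoid) (wd : m -> word) (gi : nat -> m).
Variables (rs : seq rule) (fuel : nat).
Hypothesis wd_mul : forall i j,
  normalize rs fuel (wd i ++ wd j) = (twt i j, wd (tmul i j)).
Hypothesis wd_one : wd (tone m) = [::].

Section ToAlgebra.
Variables (A : algType R) (gen : nat -> A).
Hypothesis rsP : forall rl, rl \in rs -> rule_holds d gen rl.

Definition word_hom (x : talg d m) : A := \sum_i x i *: weval gen (wd i).

Lemma word_hom_delta i : word_hom (tdelta d i) = weval gen (wd i).
Proof.
rewrite /word_hom (bigD1 i) //= tdeltaE eqxx scale1r big1 ?addr0 // => j.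
by rewrite tdeltaE eq_sym => /negPf ->; rewrite scale0r.
Qed.

(** Multiplicativity is soundness of rewriting: the concatenation of two stored words equals in [A]
    the scaled word of their product. *)
Lemma word_hom_alg : alg_hom word_hom.
Proof.
have hL : linmap word_hom.
  move=> c x y; rewrite /word_hom scaler_sumr -big_split; apply: eq_bigr => i _.
  by rewrite !talgE scalerDl scalerA.
split; [exact: linmapD hL|exact: linmapZ hL| |]; last first.
  by rewrite -tdelta1 word_hom_delta wd_one /weval big_nil.
move=> x y; move: x; apply: talg_lin_ext => [c x x'|c x x'|i].
- by rewrite mulrDl -scalerAl hL.
- by rewrite hL mulrDl -scalerAl.
move: y; apply: talg_lin_ext => [c y y'|c y y'|j].
- by rewrite mulrDr -scalerAr hL.
- by rewrite hL mulrDr -scalerAr.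
rewrite tdeltaM (linmapZ hL) !word_hom_delta -weval_cat.
by rewrite (normalize_sound rsP fuel (wd i ++ wd j)) wd_mul.
Qed.

End ToAlgebra.

Definition mword (w : word) : nat * m :=
  foldl (fun p x => ((p.1 + twt p.2 (gi x))%N, tmul p.2 (gi x))) (0%N, tone m) w.

Lemma weval_talg w : weval (fun x => tdelta d (gi x)) w =
  d ^+ (mword w).1 *: tdelta d (mword w).2.
Proof.
elim/last_ind: w => [|w x IH]; first by rewrite /weval big_nil scale1r tdelta1.
rewrite -cats1 weval_cat weval1 IH /mword foldl_cat /=.
by rewrite -scalerAl tdeltaM scalerA exprD.
Qed.

Lemma rule_holds_talg (rl : rule) :
  mword rl.1 = ((rl.2.1 + (mword rl.2.2).1)%N, (mword rl.2.2).2) ->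
  rule_holds d (fun x => tdelta d (gi x)) rl.
Proof. by move=> E; rewrite /rule_holds !weval_talg E /= scalerA exprD. Qed.

End MonoidOfWords.

(** Letters from 3 on all stand for [e1], through the default value of [nth]. *)
Definition br_gen (A : Type) (r0 r1 e0 e1 : A) (x : nat) : A :=
  nth e1 [:: r0; r1; e0] x.

Lemma br_gen_map (A B : Type) (f : A -> B) r0 r1 e0 e1 x :
  f (br_gen r0 r1 e0 e1 x) = br_gen (f r0) (f r1) (f e0) (f e1) x.
Proof. by case: x => [|[|[|x]]] //=; rewrite /br_gen /= !nth_nil. Qed.

Local Open Scope nat_scope.

(* Letters 0, 1, 2, 3 stand for r0, r1, e0, e1, and a rule [(l, (k, r))] means
   l = delta^k r. *)
Definition br_rels : seq rule :=
  [:: ([:: 0; 0], (0, [::]));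
      ([:: 1; 1], (0, [::]));
      ([:: 0; 2], (0, [:: 2]));
      ([:: 2; 0], (0, [:: 2]));
      ([:: 1; 3], (0, [:: 3]));
      ([:: 3; 1], (0, [:: 3]));
      ([:: 2; 2], (3, [:: 2]));
      ([:: 3; 3], (1, [:: 3]));
      ([:: 0; 3; 2], (0, [:: 1; 2]));
      ([:: 2; 3; 0], (0, [:: 2; 1]));
      ([:: 3; 0; 3; 0; 3], (0, [:: 3]));
      ([:: 3; 0; 3; 0; 1], (0, [:: 3; 0; 1; 0]));
      ([:: 2; 1; 2], (2, [:: 2]));
      ([:: 1; 0; 3; 0; 3], (0, [:: 0; 1; 0; 3]));
      (flatten (nseq 6 [:: 1; 0]), (0, [::]))].

(* The Knuth-Bendix completion of the defining relations for the shortlex order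
   with r0 < r1 < e1 < e0. *)
Definition br_rules : seq rule := take 14 br_rels ++
  [:: ([:: 0; 1; 2], (0, [:: 3; 2]));
      ([:: 2; 1; 0], (0, [:: 2; 3]));
      ([:: 2; 3; 2], (2, [:: 2]));
      ([:: 1; 0; 1; 0; 3], (0, [:: 0; 3; 0; 3]));
      ([:: 3; 0; 1; 0; 1], (0, [:: 3; 0; 3; 0]));
      ([:: 3; 0; 1; 0; 3], (0, [:: 3]));
      ([:: 1; 0; 1; 0; 1; 0], (0, [:: 0; 1; 0; 1; 0; 1]));
      ([:: 1; 0; 3; 0; 1; 0], (0, [:: 0; 1; 0; 3; 0; 1]))].
Local Open Scope ring_scope.

Section BrauerRelations.
Variables (R : fieldType) (d : R) (A : algType R) (r0 r1 e0 e1 : A).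
Local Notation gen := (br_gen r0 r1 e0 e1).
Local Notation holds := (rule_holds d gen).

Lemma BrG2_relP :
  BrG2_rel d r0 r1 e0 e1 <-> forall rl, rl \in br_rels -> holds rl.
Proof.
have bigE := (big_cons, big_nil, mulr1, mulrA, expr0, expr1, scale1r).
split=> [[[h1 h2] [[h3 h4 h5 h6] [[h7 h8] [[h9 h10] [[h11 h12] [h13 [h14 h15]]]]]]]|h].
  have h15' : r1 * r0 * r1 * r0 * r1 * r0 * r1 * r0 * r1 * r0 * r1 * r0 = 1.
    by rewrite -h15 !exprS expr0 mulr1 !mulrA.
  move=> rl; rewrite /br_rels !inE.
  do ![case/orP => [/eqP->|]] => [||||||||||||||/eqP->];
    by rewrite /rule_holds /weval /= /br_gen !bigE /=.
have hh i : (i < 15)%N -> holds (nth ([::], (0%N, [::])) br_rels i).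
  by move=> lt_i; apply/h/mem_nth.
do !split; [move: (hh 0%N isT) | move: (hh 1%N isT) | move: (hh 2%N isT)
  | move: (hh 3%N isT) | move: (hh 4%N isT) | move: (hh 5%N isT) | move: (hh 6%N isT)
  | move: (hh 7%N isT) | move: (hh 8%N isT) | move: (hh 9%N isT) | move: (hh 10%N isT)
  | move: (hh 11%N isT) | move: (hh 12%N isT) | move: (hh 13%N isT)
  | move: (hh 14%N isT)];
  rewrite /rule_holds /weval /= /br_gen !bigE /= => // <-.
by rewrite !exprS expr0 mulr1 !mulrA.
Qed.

(** The first 14 rules are defining relations. The facts [D1] to [D8] are the eight added rules, in
    order; [D7] takes the place of the relation of length 12. *)
Lemma br_rules_hold :
  BrG2_rel d r0 r1 e0 e1 -> forall rl, rl \in br_rules -> holds rl.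
Proof.
move=> Hrel rl; rewrite mem_cat => /orP[/mem_take|]; first exact: (BrG2_relP.1 Hrel).
have bigE := (big_cons, big_nil, mulr1, mulrA, expr0, expr1, scale1r).
case: Hrel => [[h1 h2] [[h3 h4 h5 h6] [[h7 h8] [[h9 h10] [[h11 h12] [h13 [h14 h15]]]]]]].
have r0K x : x * r0 * r0 = x by rewrite -mulrA h1 mulr1.
have r1K x : x * r1 * r1 = x by rewrite -mulrA h2 mulr1.
have D1 : r0 * r1 * e0 = e1 * e0 by rewrite -mulrA -h9 !mulrA h1 mul1r.
have D2 : e0 * r1 * r0 = e0 * e1 by rewrite -h10 r0K.
have D3 : e0 * e1 * e0 = d ^+ 2 *: e0 by rewrite -D2 -mulrA h3 h13.
have D4 : r1 * r0 * r1 * r0 * e1 = r0 * e1 * r0 * e1.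
  by rewrite -3!mulrA [r0 * (r1 * _)]mulrA [_ * (r0 * e1)]mulrA -h14 !mulrA h2 mul1r.
have D5 : e1 * r0 * r1 * r0 * r1 = e1 * r0 * e1 * r0 by rewrite -h12 r1K.
have D6 : e1 * r0 * r1 * r0 * e1 = e1.
  by rewrite -h12 -[_ * r1 * e1]mulrA h5 h11.
(* Multiplication on the right by six letters cancels the second half of the relation. *)
have D7 : r1 * r0 * r1 * r0 * r1 * r0 = r0 * r1 * r0 * r1 * r0 * r1.
  have := congr1 (fun x => x * r0 * r1 * r0 * r1 * r0 * r1) h15.
  by rewrite !exprS expr0 mulr1 !mulrA !(r0K, r1K) mul1r.
(* Both sides equal [r1 * r0 * e1 * r0 * e1 * r0 * r1]. *)
have D8 : r1 * r0 * e1 * r0 * r1 * r0 = r0 * r1 * r0 * e1 * r0 * r1.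
  by rewrite -h14 -!mulrA; congr (_ * (_ * _)); rewrite !mulrA h12.
rewrite !inE; do ![case/orP => [/eqP->|]] => [|||||||/eqP->];
  by rewrite /rule_holds /weval /= /br_gen !bigE /=.
Qed.

End BrauerRelations.

(** * Layered monoids given by tables *)

Section LayeredTables.
Local Open Scope nat_scope.
Variables (n one : nat) (mul wt : nat -> nat -> nat) (flip : nat -> nat).
Variables (nl : nat) (ldim lgrp : nat -> nat) (lay row col grp : nat -> nat).
Variables (pos : nat -> nat -> nat -> nat -> nat) (idem_wt : nat -> nat).
Variables (sizes : nat -> seq nat) (vec dual : nat -> nat -> nat -> int).

(** The group of a layer is read off from its corner of row 0 and column 0. The powers of delta in
    these products are dropped, and element 0 is to be the identity. *)
Definition gmul l b b' := grp (mul (pos l 0 0 b) (pos l 0 0 b')).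
Definition gflip l b := grp (flip (pos l 0 0 b)).

Definition coord_check : bool := all_lt n.+1 (fun k =>
  [&& lay k < nl.+1, row k < (ldim (lay k)).+1, col k < (ldim (lay k)).+1,
      grp k < (lgrp (lay k)).+1 & pos (lay k) (row k) (col k) (grp k) == k]).

Definition all_pos (P : nat -> nat -> nat -> nat -> bool) : bool :=
  all_lt nl.+1 (fun l => all_lt (ldim l).+1 (fun i => all_lt (ldim l).+1 (fun j =>
    all_lt (lgrp l).+1 (fun b => P l i j b)))).

Definition pos_check : bool := all_pos (fun l i j b => let k := pos l i j b in
  [&& k < n.+1, lay k == l, row k == i, col k == j & grp k == b]).

Definition lay_mul_check : bool := all_lt n.+1 (fun i => all_lt n.+1 (fun j =>
  (lay (mul i j) <= lay i) && (lay (mul i j) <= lay j))).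

Definition coord_flip_check : bool := all_lt n.+1 (fun k =>
  [&& lay (flip k) == lay k, row (flip k) == col k, col (flip k) == row k
    & grp (flip k) == gflip (lay k) (grp k)]).

Definition left_action_check : bool := all_pos (fun l i j b =>
  all_lt n.+1 (fun p =>
    let q := pos l i j b in let q0 := pos l i 0 0 in
    let s := mul p q in let s0 := mul p q0 in
    if lay s0 == l then
      (s == pos l (row s0) j (gmul l (grp s0) b)) && (wt p q == wt p q0)
    else lay s < l)).

Definition form_check : bool := all_pos (fun l i j b =>
  all_lt (ldim l).+1 (fun i' =>
    let p := pos l i j b in let p0 := pos l 0 j 0 in let q0 := pos l i' 0 0 in
    let s := mul p q0 in let s0 := mul p0 q0 in
    if lay s0 == l then
      [&& lay s == l, row s == i, grp s == gmul l b (grp s0) & wt p q0 == wt p0 q0]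
    else lay s != l)).

Definition form_flip_check : bool := all_lt nl.+1 (fun l =>
  all_lt (ldim l).+1 (fun i => all_lt (ldim l).+1 (fun j =>
    let s := mul (pos l 0 i 0) (pos l j 0 0) in
    let s' := mul (pos l 0 j 0) (pos l i 0 0) in
    [&& lay s == lay s', (lay s == l) ==> (grp s == gflip l (grp s'))
      & wt (pos l 0 i 0) (pos l j 0 0) == wt (pos l 0 j 0) (pos l i 0 0)]))).

Definition idem_check : bool := all_lt nl.+1 (fun l => all_lt l.+1 (fun l' =>
  let p := pos l 0 0 0 in let q := pos l' 0 0 0 in
  [&& mul p q == q, mul q p == q, wt p q == idem_wt l & wt q p == idem_wt l])).

Definition group_check : bool := all_lt nl.+1 (fun l =>
  tmonoid_check (lgrp l) 0 (gmul l) (fun _ _ => 0) &&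
  flip_check (lgrp l) (gmul l) (fun _ _ => 0) (gflip l)).

Definition group_cell_check : bool := all_lt nl.+1 (fun l =>
  [&& cell_pos_check (lgrp l) (sizes l), cell_dual_check (lgrp l) (vec l) (dual l),
      cell_flip_check (lgrp l) (gflip l) (sizes l) (vec l)
    & cell_mul_check (lgrp l) (gmul l) (sizes l) (vec l) (dual l)]).

Hypothesis monT : tmonoid_check n one mul wt.
Hypothesis flipT : flip_check n mul wt flip.
Hypothesis coordT : coord_check.
Hypothesis posT : pos_check.
Hypothesis lay_mulT : lay_mul_check.
Hypothesis coord_flipT : coord_flip_check.
Hypothesis left_actionT : left_action_check.
Hypothesis formT : form_check.
Hypothesis form_flipT : form_flip_check.
Hypothesis idemT : idem_check.
Hypothesis groupT : group_check.
Hypothesis group_cellT : group_cell_check.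

Local Notation T := 'I_n.+1.
Local Notation L := 'I_nl.+1.

Let groupP (l : L) : tmonoid_check (lgrp l) 0 (gmul l) (fun _ _ => 0).
Proof. by case/all_ordP/(_ l)/andP: groupT. Qed.

Let gflipP (l : L) : flip_check (lgrp l) (gmul l) (fun _ _ => 0) (gflip l).
Proof. by case/all_ordP/(_ l)/andP: groupT. Qed.

Let G (l : L) : tmonoid := ord_tmonoid (groupP l).
Let gflipI (l : L) : G l -> G l := ord_flip (gflip l).
Let layI (k : T) : L := inord (lay k).
Let rowI (l : L) (k : T) : 'I_(ldim l).+1 := inord (row k).
Let colI (l : L) (k : T) : 'I_(ldim l).+1 := inord (col k).
Let grpI (l : L) (k : T) : G l := inord (grp k).
Let posI (l : L) (i j : 'I_(ldim l).+1) (b : G l) : T :=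
  inord (pos l i j (b : 'I_(lgrp l).+1)).

Let all_posP P : all_pos P ->
  forall (l : L) (i j : 'I_(ldim l).+1) (b : 'I_(lgrp l).+1), P l i j b.
Proof.
move=> /all_ordP h l i j b.
by move: (h l) => /all_ordP/(_ i)/all_ordP/(_ j)/all_ordP/(_ b).
Qed.

Let posIE (l : L) i j b : posI (l := l) i j b = pos l i j (b : 'I_(lgrp l).+1) :> nat.
Proof.
by rewrite inordK //; have /all_posP/(_ l i j b)/and5P[] := posT.
Qed.

Let goneE (l : L) : (tone (G l) : 'I_(lgrp l).+1) = 0 :> nat.
Proof. exact: (ord_oneE (groupP l)). Qed.

Let colposE (l : L) i : posI (l := l) i ord0 (tone (G l)) = pos l i 0 0 :> nat.
Proof. by rewrite posIE goneE. Qed.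

Let rowposE (l : L) j : posI (l := l) ord0 j (tone (G l)) = pos l 0 j 0 :> nat.
Proof. by rewrite posIE goneE. Qed.

Let layIE k : layI k = lay k :> nat.
Proof. by rewrite inordK //; case/all_ordP/(_ k)/and5P: coordT. Qed.

Let layI_eq (k : T) (l : L) : layI k = l -> lay k = l.
Proof. by move=> <-; rewrite layIE. Qed.

Let eq_layI (k : T) (l : L) : lay k = l -> layI k = l.
Proof. by move=> E; apply/val_inj; rewrite /= layIE. Qed.

Let rowIE (l : L) k : layI k = l -> rowI l k = row k :> nat.
Proof.
by move/layI_eq=> E; rewrite inordK -?E //; case/all_ordP/(_ k)/and5P: coordT.
Qed.
Let colIE (l : L) k : layI k = l -> colI l k = col k :> nat.
Proof.
by move/layI_eq=> E; rewrite inordK -?E //; case/all_ordP/(_ k)/and5P: coordT.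
Qed.
Let grpIE (l : L) k : layI k = l -> (grpI l k : 'I_(lgrp l).+1) = grp k :> nat.
Proof.
by move/layI_eq=> E; rewrite inordK -?E //; case/all_ordP/(_ k)/and5P: coordT.
Qed.

(** Each check supplies a hypothesis of [layered_stratified]; what remains is the passage between
    ordinals and their underlying numbers. *)
Lemma layered_tables_stratified (R : fieldType) (d : R) : (d != 0)%R ->
  cellularly_stratified (@tflip R d (ord_tmonoid monT) (ord_flip flip)).
Proof.
move=> d0.
have mulE (x y : T) : ord_mul (n := n) mul x y = mul x y :> nat.
  exact: (ord_mulE monT).
have posP (l : L) i j (b : G l) := all_posP posT i j (b : 'I_(lgrp l).+1).
have coords_pos (l : L) i j (b : G l) : layI (posI i j b) = l.
  by apply/eq_layI; rewrite posIE; case/and5P: (posP l i j b) => _ /eqP.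
apply: (@layered_stratified R d (ord_tmonoid monT) _ _ G gflipI
          (fun l => ldim l) layI rowI colI grpI posI (fun l => idem_wt l)) => //.
- move=> l k lk; apply/val_inj; rewrite /= posIE rowIE // colIE // grpIE //.
  by rewrite -(layI_eq lk); case/all_ordP/(_ k)/and5P: coordT => _ _ _ _ /eqP.
- move=> l i j b; apply/val_inj; rewrite /= rowIE // posIE.
  by case/and5P: (posP l i j b) => _ _ /eqP.
- move=> l i j b; apply/val_inj; rewrite /= colIE // posIE.
  by case/and5P: (posP l i j b) => _ _ _ /eqP.
- move=> l i j b; apply/val_inj; rewrite /= grpIE // posIE.
  by case/and5P: (posP l i j b) => _ _ _ _ /eqP.
- move=> x y; rewrite !layIE mulE; apply/andP.
  by case/all_ordP/(_ x)/all_ordP/(_ y)/andP: lay_mulT => -> ->.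
- move=> l; have /all_ordP/(_ l)/and4P[h1 h2 h3 h4] := group_cellT.
  exact: (ord_cellular (groupP l) (gflipP l) (fun _ _ => erefl) h1 h2 h3 h4).
- by move=> l; apply: (ord_flipK (gflipP l)).
- exact: (ord_flip_anti monT flipT).
- move=> k; apply/val_inj; rewrite /= !layIE (ord_flipE flipT).
  by case/all_ordP/(_ k)/and4P: coord_flipT => /eqP.
- move=> l k lk; apply/val_inj; rewrite /= rowIE ?colIE ?(ord_flipE flipT) //.
    by case/all_ordP/(_ k)/and4P: coord_flipT => _ /eqP.
  (* The layer of the flipped element must be known before its row is read as an ordinal of the
     right size. *)
  apply: eq_layI; rewrite (ord_flipE flipT) -(layI_eq lk).
  by case/all_ordP/(_ k)/and4P: coord_flipT => /eqP.
- move=> l k lk; apply/val_inj; rewrite /= colIE ?rowIE ?(ord_flipE flipT) //.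
    by case/all_ordP/(_ k)/and4P: coord_flipT => _ _ /eqP.
  apply: eq_layI; rewrite (ord_flipE flipT) -(layI_eq lk).
  by case/all_ordP/(_ k)/and4P: coord_flipT => /eqP.
- move=> l k lk; apply/val_inj.
  rewrite /= grpIE ?(ord_flipE (gflipP l)) ?grpIE ?(ord_flipE flipT) //.
    by rewrite -(layI_eq lk); case/all_ordP/(_ k)/and4P: coord_flipT => _ _ _ /eqP.
  apply: eq_layI; rewrite (ord_flipE flipT) -(layI_eq lk).
  by case/all_ordP/(_ k)/and4P: coord_flipT => /eqP.
- move=> l p i j b s0 s.
  have := all_posP left_actionT i j (b : 'I_(lgrp l).+1) => /all_ordP/(_ p) /=.
  have s0E : s0 = mul p (pos l i 0 0) :> nat by rewrite mulE colposE.
  have sE : s = mul p (pos l i j (b : 'I_(lgrp l).+1)) :> nat by rewrite mulE posIE.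
  rewrite -s0E -sE; case: eqP => [/eq_layI ls0 /andP[/eqP Es /eqP Ew]|ns0 lt_s].
    left; split=> //; split; last by rewrite /= /ord_wt posIE colposE.
    apply/val_inj; rewrite /= posIE rowIE // Es; congr (pos _ _ _ _).
    by rewrite (ord_mulE (groupP l)) grpIE.
  by right; split; [move/layI_eq | rewrite layIE].
- move=> l i j b i' s0 s.
  have := all_posP formT i j (b : 'I_(lgrp l).+1) => /all_ordP/(_ i') /=.
  have s0E : s0 = mul (pos l 0 j 0) (pos l i' 0 0) :> nat.
    by rewrite mulE colposE rowposE.
  have sE : s = mul (pos l i j (b : 'I_(lgrp l).+1)) (pos l i' 0 0) :> nat.
    by rewrite mulE posIE colposE.
  rewrite -s0E -sE; case: eqP => [/eq_layI ls0|ns0 /eqP ns]; last first.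
    by right; split; move/layI_eq.
  case/and4P=> /eqP/eq_layI ls /eqP Er /eqP Eg /eqP Ew.
  left; split=> //; split=> //.
  + by apply/val_inj; rewrite /= rowIE.
  + by apply/val_inj; rewrite /= grpIE // (ord_mulE (groupP l)) grpIE.
  by rewrite /= /ord_wt posIE colposE rowposE.
- move=> l i j s s'.
  have /all_ordP/(_ l)/all_ordP/(_ i)/all_ordP/(_ j) /= := form_flipT.
  have sE : s = mul (pos l 0 i 0) (pos l j 0 0) :> nat by rewrite mulE colposE rowposE.
  have s'E : s' = mul (pos l 0 j 0) (pos l i 0 0) :> nat by rewrite mulE colposE rowposE.
  rewrite -sE -s'E => /and3P[/eqP El Eg /eqP Ew]; split.
  + by apply/val_inj; rewrite /= !layIE.
  + move=> ls; have ls' : layI s' = l by apply: eq_layI; rewrite -El (layI_eq ls).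
    apply/val_inj; rewrite /= grpIE // (ord_flipE (gflipP l)) grpIE //.
    by move/implyP: Eg => /(_ _)/eqP; apply; rewrite (layI_eq ls).
  by rewrite /= /ord_wt !colposE !rowposE.
move=> l l' le_l e e'.
have eE : e = pos l 0 0 0 :> nat by rewrite /e colposE.
have e'E : e' = pos l' 0 0 0 :> nat by rewrite /e' colposE.
have /all_ordP/(_ l)/all_ltP/(_ l' le_l) /= := idemT.
rewrite -eE -e'E => /and4P[/eqP h1 /eqP h2 /eqP h3 /eqP h4].
by split=> //; apply/val_inj; rewrite /= mulE.
Qed.

End LayeredTables.

(** * The Brauer monoid of type G_2 *)

Section OrdWords.
Local Open Scope nat_scope.
Variables (n one : nat) (mul wt : nat -> nat -> nat) (gx : nat -> nat).
Variables (words : seq word) (rs rels : seq rule) (fuel : nat).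
Hypothesis monT : tmonoid_check n one mul wt.

Local Notation m := (ord_tmonoid monT).
Definition ord_wd (i : m) : word := nth [::] words (i : 'I_n.+1).
Definition ord_gi (x : nat) : m := inord (gx x).

Definition nword (w : word) : nat * nat :=
  foldl (fun p x => (p.1 + wt p.2 (gx x), mul p.2 (gx x))) (0, one) w.

(** Normal forms of concatenations make the map from the table algebra multiplicative. Evaluating
    each stored word to its own index, with exponent 0, makes that map invertible. *)
Definition words_check : bool :=
  (nth [::] words one == [::]) && all_lt n.+1 (fun i =>
    (nword (nth [::] words i) == (0, i)) && all_lt n.+1 (fun j =>
      normalize rs fuel (nth [::] words i ++ nth [::] words j) ==
      (wt i j, nth [::] words (mul i j)))).

Definition rels_check : bool :=
  all (fun rl => nword rl.1 == (rl.2.1 + (nword rl.2.2).1, (nword rl.2.2).2)) rels.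

Hypothesis gx_lt : forall x, gx x < n.+1.
Hypothesis wordsT : words_check.
Hypothesis relsT : rels_check.

Lemma ord_mwordE w : (mword ord_gi w).1 = (nword w).1 /\
  ((mword ord_gi w).2 : 'I_n.+1) = (nword w).2 :> nat.
Proof.
elim/last_ind: w => [|w x [IH1 IH2]]; first by split; rewrite //= (ord_oneE monT).
rewrite /mword /nword -cats1 !foldl_cat /= -/(mword _ _) -/(nword _).
by rewrite /ord_wt IH1 IH2 (ord_mulE monT) IH2 inordK.
Qed.

Lemma ord_wd_mul (i j : m) :
  normalize rs fuel (ord_wd i ++ ord_wd j) = (twt i j, ord_wd (tmul i j)).
Proof.
rewrite /ord_wd (ord_mulE monT).
by case/andP: wordsT => _ /all_ordP/(_ i)/andP[_ /all_ordP/(_ j)/eqP].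
Qed.

Lemma ord_wd_one : ord_wd (tone m) = [::].
Proof. by rewrite /ord_wd (ord_oneE monT); case/andP: wordsT => /eqP. Qed.

Lemma ord_wdK (R : fieldType) (d : R) (i : m) :
  weval (fun x => tdelta d (ord_gi x)) (ord_wd i) = tdelta d i.
Proof.
rewrite weval_talg; have [-> E] := ord_mwordE (ord_wd i).
case/andP: wordsT => _ /all_ordP/(_ i)/andP[/eqP Ei _].
rewrite {1}/ord_wd Ei scale1r; congr tdelta; apply/val_inj.
by rewrite /= E /ord_wd Ei.
Qed.

Lemma ord_rels_hold (R : fieldType) (d : R) rl : rl \in rels ->
  rule_holds d (fun x => tdelta d (ord_gi x)) rl.
Proof.
move=> /(allP relsT)/eqP E; apply: rule_holds_talg.
have [E1 E2] := ord_mwordE rl.1; have [E3 E4] := ord_mwordE rl.2.2.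
rewrite [LHS]surjective_pairing; congr pair; first by rewrite E1 E E3.
by apply/val_inj; rewrite /= E2 E E4.
Qed.

End OrdWords.

Section BrauerTables.
Local Open Scope nat_scope.

Definition br_normalize : word -> nat * word := normalize br_rules 60.

(** In layer 0 the representative r0 r1 comes first because r0 r1 e0 = e1 e0: multiplication by e1
    scales it by delta, as the idempotent condition requires. This fails for e0 itself. *)
Definition layer_reps (l : nat) : seq word :=
  nth [::] [:: [:: [:: 0; 1]; [:: 1]; [::]];
               [:: [::]; [:: 0]; [:: 1; 0]];
               [:: [::]]] l.

(* In layer 2 the dihedral group is listed as S_3 x {1, c}, with S_3 generated
   by s = r0 and t = r1 r0 r1 and c = (r0 r1)^3 central, in the order
   1, s, t, st, ts, sts, c, cs, ct, cst, cts, csts. *)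
Definition layer_cores (l : nat) : seq word :=
  nth [::] [:: [:: [:: 2]];
               [:: [:: 3]; [:: 3; 0; 3]];
               [:: [::]; [:: 0]; [:: 1; 0; 1]; [:: 0; 1; 0; 1]; [:: 1; 0; 1; 0];
                   [:: 0; 1; 0; 1; 0]; [:: 0; 1; 0; 1; 0; 1];
                   [:: 1; 0; 1; 0; 1]; [:: 0; 1; 0]; [:: 1; 0]; [:: 0; 1];
                   [:: 1]]] l.

Definition br_ldim (l : nat) : nat := (size (layer_reps l)).-1.
Definition br_lgrp (l : nat) : nat := (size (layer_cores l)).-1.

Definition br_coords : seq (nat * nat * nat * nat) :=
  flatten [seq [seq (l, ij.1, ij.2, b) |
      ij <- [seq (i, j) | i <- iota 0 (br_ldim l).+1, j <- iota 0 (br_ldim l).+1],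
      b <- iota 0 (br_lgrp l).+1] | l <- iota 0 3].

(* The basis element (l, i, j, b) is a_i c_b a_j^*, for the representatives a
   and the cores c of layer l. *)
Definition br_words : seq word :=
  [seq let: (l, i, j, b) := q in
       (br_normalize (nth [::] (layer_reps l) i ++ nth [::] (layer_cores l) b ++
                      rev (nth [::] (layer_reps l) j))).2 | q <- br_coords].

Definition br_table : seq (seq (nat * nat)) :=
  [seq [seq let p := br_normalize (w ++ w') in (p.1, index p.2 br_words)
       | w' <- br_words] | w <- br_words].

Definition br_prod (i j : nat) : nat * nat := nth (0, 0) (nth [::] br_table i) j.
Definition br_mul i j := (br_prod i j).2.
Definition br_wt i j := (br_prod i j).1.
Definition br_one : nat := index [::] br_words.

(** The anti-involution reverses words. Reversal permutes the defining relations, up to replacing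
    (r1 r0)^6 = 1 by the equivalent (r0 r1)^6 = 1. *)
Definition br_flip_table : seq nat :=
  [seq index (br_normalize (rev w)).2 br_words | w <- br_words].
Definition br_flip (k : nat) : nat := nth 0 br_flip_table k.

Definition br_coord k := nth (0, 0, 0, 0) br_coords k.
Definition br_lay k := let: (l, _, _, _) := br_coord k in l.
Definition br_row k := let: (_, i, _, _) := br_coord k in i.
Definition br_col k := let: (_, _, j, _) := br_coord k in j.
Definition br_grp k := let: (_, _, _, b) := br_coord k in b.
Definition br_pos (l i j b : nat) : nat := index (l, i, j, b) br_coords.

Definition br_idem_wt (l : nat) : nat := nth 0 [:: 3; 1; 0] l.

(* Cell data over the integers.  In layer 2 this is the tensor product of the
   Kazhdan-Lusztig basis of Z[S_3], consisting of the sum over S_3, the 2 x 2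
   block 1 + s, (1 + s)(1 + t), (1 + t)(1 + s), 1 + t, and 1, with the basis
   1 + c, 1 of Z[<c>]; every basis element is a sum of distinct group elements. *)
Definition br_cell_sizes (l : nat) : seq nat :=
  nth [::] [:: [:: 0]; [:: 0; 0]; [:: 0; 0; 1; 1; 0; 0]] l.

Definition cell_sums (l : nat) : seq (seq nat) :=
  nth [::]
   [:: [:: [:: 0]];
       [:: [:: 0; 1]; [:: 0]];
       [:: iota 0 12; iota 0 6;
           [:: 0; 1; 6; 7]; [:: 0; 1; 2; 3; 6; 7; 8; 9];
           [:: 0; 1; 2; 4; 6; 7; 8; 10]; [:: 0; 2; 6; 8];
           [:: 0; 1]; [:: 0; 1; 2; 3]; [:: 0; 1; 2; 4]; [:: 0; 2];
           [:: 0; 6]; [:: 0]]] l.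

(* The dual basis: the group elements with coefficient 1, resp. -1. *)
Definition cell_duals (l : nat) : seq (seq nat * seq nat) :=
  nth [::]
   [:: [:: ([:: 0], [::])];
       [:: ([:: 1], [::]); ([:: 0], [:: 1])];
       [:: ([:: 11], [::]); ([:: 5], [:: 11]);
           ([:: 7; 11], [:: 9; 10]); ([:: 9], [:: 11]);
           ([:: 10], [:: 11]); ([:: 8; 11], [:: 9; 10]);
           ([:: 1; 5; 9; 10], [:: 3; 4; 7; 11]); ([:: 3; 11], [:: 5; 9]);
           ([:: 4; 11], [:: 5; 10]); ([:: 2; 5; 9; 10], [:: 3; 4; 8; 11]);
           ([:: 6; 9; 10], [:: 7; 8; 11]);
           ([:: 0; 3; 4; 7; 8; 11], [:: 1; 2; 5; 6; 9; 10])]] l.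

Definition br_vec (l k b : nat) : int := (b \in nth [::] (cell_sums l) k)%:R%R.
Definition br_dual (l k b : nat) : int :=
  let: (p, q) := nth ([::], [::]) (cell_duals l) k in
  ((b \in p)%:R - (b \in q)%:R)%R.

(** Associativity and the cocycle identity are evaluated on all triples of the 39 words; this is
    where confluence of the rules shows. *)
Lemma br_monT : tmonoid_check 38 br_one br_mul br_wt.
Proof. by vm_compute. Qed.

Lemma br_flipT : flip_check 38 br_mul br_wt br_flip.
Proof. by vm_compute. Qed.

Definition br_monoid : tmonoid := ord_tmonoid br_monT.
Definition br_flipI : br_monoid -> br_monoid := ord_flip br_flip.

Lemma br_stratified (R : fieldType) (d : R) : (d != 0)%R ->
  cellularly_stratified (@tflip R d br_monoid br_flipI).
Proof.
move=> d0.
refine (@layered_tables_stratified 38 br_one br_mul br_wt br_flip 2 br_ldim br_lgrp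
  br_lay br_row br_col br_grp br_pos br_idem_wt br_cell_sizes br_vec br_dual br_monT
  _ _ _ _ _ _ _ _ _ _ _ R d d0).
all: by vm_compute.
Qed.


Definition br_gx : nat -> nat :=
  br_gen (index [:: 0] br_words) (index [:: 1] br_words) (index [:: 2] br_words)
         (index [:: 3] br_words).

Definition br_gi : nat -> br_monoid := ord_gi br_gx br_monT.
Definition br_wd : br_monoid -> word := @ord_wd _ _ _ _ br_words br_monT.

Lemma br_gx_lt x : br_gx x < 39.
Proof. by case: x => [|[|[|x]]]; rewrite /br_gx /br_gen /= ?nth_nil; vm_compute. Qed.

Lemma br_wordsT : words_check 38 br_one br_mul br_wt br_gx br_words br_rules 60.
Proof. by vm_compute. Qed.

Lemma br_relsT : rels_check br_one br_mul br_wt br_gx br_rels.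
Proof. by vm_compute. Qed.

Lemma br_wd_mul (i j : br_monoid) :
  normalize br_rules 60 (br_wd i ++ br_wd j) = (twt i j, br_wd (tmul i j)).
Proof. exact (ord_wd_mul br_wordsT i j). Qed.

Lemma br_wd_one : br_wd (tone br_monoid) = [::].
Proof. exact (ord_wd_one br_monT br_wordsT). Qed.

Lemma br_wdK (R : fieldType) (d : R) (i : br_monoid) :
  weval (fun x => tdelta d (br_gi x)) (br_wd i) = tdelta d i.
Proof. exact (ord_wdK br_gx_lt br_wordsT d i). Qed.

(** Generators are their own normal forms and are fixed by reversal; hence the final involution
    fixes them. *)
Lemma br_gx_check : all_lt 4 (fun x =>
  (nth [::] br_words (br_gx x) == [:: x]) && (br_flip (br_gx x) == br_gx x)).
Proof. by vm_compute. Qed.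

Lemma br_wd_gi x : x < 4 -> br_wd (br_gi x) = [:: x].
Proof.
move=> x4; rewrite /br_wd /br_gi /ord_wd /ord_gi inordK; last exact: br_gx_lt.
by case/all_ltP/(_ x x4)/andP: br_gx_check => /eqP.
Qed.

Lemma br_flip_gi x : x < 4 -> br_flipI (br_gi x) = br_gi x.
Proof.
move=> x4; apply/val_inj; rewrite /= (ord_flipE br_flipT) inordK; last exact: br_gx_lt.
by case/all_ltP/(_ x x4)/andP: br_gx_check => _ /eqP.
Qed.

End BrauerTables.

(** * Identification with the presented algebra *)

Lemma br_gen_talg (R : fieldType) (d : R) x : tdelta d (br_gi x) =
  br_gen (tdelta d (br_gi 0)) (tdelta d (br_gi 1)) (tdelta d (br_gi 2))
         (tdelta d (br_gi 3)) x.
Proof.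
exact: (br_gen_map (fun i => tdelta d (inord i : br_monoid))).
Qed.

Lemma br_rel_talg (R : fieldType) (d : R) :
  BrG2_rel d (tdelta d (br_gi 0)) (tdelta d (br_gi 1)) (tdelta d (br_gi 2))
             (tdelta d (br_gi 3)).
Proof.
apply/BrG2_relP => rl /(ord_rels_hold br_monT br_gx_lt br_relsT d).
by rewrite /rule_holds !(eq_weval (br_gen_talg d)).
Qed.

Theorem theorem10p1 (R : fieldType) (d : R) (A : algType R) (r0 r1 e0 e1 : A) :
  2%N \notin [pchar R] -> 3%N \notin [pchar R] -> d != 0 ->
  BrG2_rel d r0 r1 e0 e1 ->
  BrG2_universal d r0 r1 e0 e1 ->
  exists iota : A -> A,
    [/\ iota r0 = r0, iota r1 = r1, iota e0 = e0 & iota e1 = e1] /\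
    cellularly_stratified iota.
Proof.
move=> _ _ d0 relA univA.
(* [f] comes from the universal property, since the table algebra satisfies the relations. *)
have [f [fH [f0 f1 f2 f3] _]] := univA _ _ _ _ _ (br_rel_talg d).
pose gen := br_gen r0 r1 e0 e1.
have rulesA := br_rules_hold relA.
(* [g] evaluates the stored words in [A], where all rewriting rules hold. *)
pose g := word_hom (d := d) br_wd gen.
have gH : alg_hom g by exact (word_hom_alg br_wd_mul br_wd_one rulesA).
have g_gi x : (x < 4)%N -> g (tdelta d (br_gi x)) = gen x.
  by move=> x4; rewrite /g word_hom_delta br_wd_gi // weval1.
have f_gen x : f (gen x) = tdelta d (br_gi x).
  by rewrite br_gen_talg (br_gen_map f) f0 f1 f2 f3.
have [fD fZ fM f1']:= fH; have [gD gZ gM g1] := gH.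
have fK : cancel f g.
  (* Uniqueness in the universal property of [A] mapping to itself: [g \o f] and the identity agree
     on the generators. *)
  have [h [_ _ hU]] := univA A r0 r1 e0 e1 relA.
  have idH : alg_hom (fun x : A => x) by split.
  have gfH : alg_hom (g \o f).
    split=> [x y|c x|x y|] /=; first by rewrite fD gD.
    - by rewrite fZ gZ.
    - by rewrite fM gM.
    by rewrite f1' g1.
  move=> x; rewrite -[g (f x)]/((g \o f) x) (hU _ gfH); last first.
    by split; rewrite /= ?f0 ?f1 ?f2 ?f3 g_gi.
  by rewrite -(hU _ idH).
have gK : cancel g f.
  apply: talg_lin_ext => [c x y|//|i]; first by rewrite gD gZ fD fZ.
  (* [f] turns a word in [A] into the same word in the table algebra, which is the basis element it
     came from. *)
  rewrite /g word_hom_delta /weval (big_morph f fM f1').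
  rewrite -[RHS]br_wdK.
  by apply: eq_bigr => x _; apply: f_gen.
(* The involution is word reversal, carried over to [A]. *)
exists (g \o tflip br_flipI \o f); split; last first.
  exact: cellularly_stratified_iso (br_stratified d0).
have iota_gen x : (x < 4)%N -> (g \o tflip br_flipI \o f) (gen x) = gen x.
  move=> x4 /=; rewrite f_gen tflip_delta; last exact: (ord_flipK br_flipT).
  by rewrite br_flip_gi // g_gi.
split; [exact: (iota_gen 0%N)|exact: (iota_gen 1%N)|exact: (iota_gen 2%N)|].
exact: (iota_gen 3%N).
Qed.
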